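(* Suppose that the augmented Agler decomposition $\{K_k\}_{k=1}^d$ for the Schur–Agler-class function $S\in\mathcal{SA}(\mathcal E,\mathcal E_* )$ is strictly closely connected, i.e., both overlapping spaces $\mathcal L(K_1,\dots,K_d)$ and $\mathcal L(K_1',\dots,K_d')$, where $K'_k(z,w)=z_kK_k(z,w)w_k^{-1}$, are trivial. Then there is a unique, up to unitary equivalence of colligations, closely connected GR-unitary colligation realizing $S$ compatible with this given augmented Agler decomposition. Moreover, this colligation is necessarily strictly closely connected, and if, in addition, the augmented Agler decomposition is minimal, then this colligation is scattering minimal.
   Context: **Formal series and kernels.** $\mathcal G[[z^{\pm1}]]$ is the space of formal Laurent series $\sum_{n\in\mathbb Z^d}f_nz^n$ with coefficients in the Hilbert space $\mathcal G$ and arbitrary support. Convention: $(z^n)^*=z^{-n}$, $H(z)^*=\sum H_n^*z^{-n}$. A kernel $K(z,w)=\sum K_{n,m}z^nw^{-m}$ with coefficients in $\mathcal L(\mathcal G)$ is positive if $\sum\langle K_{n,m}u_m,u_n\rangle\ge0$ for finitely supported $(u_n)$; equivalently $K=H(z)H(w)^*$. $\mathcal H(K)$ is the unique Hilbert space of formal series containing all $K_m(z)u:=\sum_nK_{n,m}u\,z^n$ with $\langle f,K_mu\rangle=\langle f_m,u\rangle$. The overlapping space of a countable family of positive kernels (with coefficientwise weak-operator convergent sum) is the kernel of the sum map $\widehat\bigoplus f_j\mapsto\sum f_j$ on the external Hilbert direct sum $\widehat\bigoplus_j\mathcal H(K_j)$; for $K_1,\dots,K_d$ it is denoted $\mathcal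 L(K_1,\dots,K_d)$. **Augmented Agler decomposition.** $\mathcal{SA}(\mathcal E,\mathcal E_* )$ is the class of holomorphic $S(z)=\sum_{n\in\mathbb Z_+^d}S_nz^n$ on $\mathbb D^d$ with $\|\sum S_n\otimes T^n\|\le1$ for all commuting $d$-tuples $T$ of strict contractions. An augmented Agler decomposition of $S$ is a collection of positive kernels $K_k=[K_k^{ij}]_{i,j=1,2}=H_k(z)H_k(w)^*$ with coefficients in $\mathcal L(\mathcal E_*\oplus\mathcal E)$, $H_k=\begin{bmatrix}H_k^1\\ H_k^2\end{bmatrix}$, $H_k^1$ supported in $\mathbb Z_+^d$, $H_k^2$ supported in $-\mathbf e_k-\mathbb Z_+^d$, such that $$\begin{bmatrix}I-S(z)S(w)^*&S(w)-S(z)\\ S(z)^*-S(w)^*&S(z)^*S(w)-I\end{bmatrix}=\sum_{k=1}^d(1-z_kw_k^{-1})K_k(z,w).$$ **Minimal decomposition.** $\Omega\subset\mathbb Z^d$ is a shift-invariant sublattice if $\Omega+\mathbf e_k\subset\Omega$ for all $k$. $\partial_k\Omega_{\rm fin}=\{n:n_k=\min\{m:(n_1,\dots,m,\dots,n_d)\in\Omega\}\}$ ($m$ in place $k$); with $\ell_{n,k}=n+\mathbb Z\mathbf e_k$, $\partial_k\Omega_{+\infty}=\{\ell_{n,k}:\ell_{n,k}\cap\Omega=\emptyset\}$, $\partial_k\Omega_{-\infty}=\{\ell_{n,k}:\ell_{n,k}\subset\Omega\}$; $(\widehat z^k)^{\widehat n^k}=\prod_{j\ne k}z_j^{n_j}$.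 Put $K^{11}_{-\infty,k}=\lim_{t\to-\infty}z_k^tw_k^{-t}K^{11}_k$, $K^{22}_{+\infty,k}=\lim_{t\to+\infty}z_k^tw_k^{-t}K_k^{22}$ (coefficientwise strong limits, which exist). The augmented Agler decomposition is minimal if it is strictly closely connected and the overlapping space of the following family is $\{0\}$: $z^nK_kw^{-n}$ ($n\in\partial_k\Omega_{\rm fin}$), $(\widehat z^k)^{\widehat{n'}^k}\begin{bmatrix}0&0\\ 0&K^{22}_{+\infty,k}\end{bmatrix}(\widehat w^k)^{-\widehat{n'}^k}$ ($\ell_{n',k}\in\partial_k\Omega_{+\infty}$), $(\widehat z^k)^{\widehat{n''}^k}\begin{bmatrix}K^{11}_{-\infty,k}&0\\ 0&0\end{bmatrix}(\widehat w^k)^{-\widehat{n''}^k}$ ($\ell_{n'',k}\in\partial_k\Omega_{-\infty}$), $k=1,\dots,d$; this notion does not depend on the choice of shift-invariant sublattice $\Omega$. **Colligations.** A GR-unitary colligation is a unitary $U=\begin{bmatrix}A&B\\ C&D\end{bmatrix}:\mathcal H\oplus\mathcal E\to\mathcal H\oplus\mathcal E_*$ with $\mathcal H=\bigoplus_{k=1}^d\mathcal H_k$; $P_k$ is the projection onto $\mathcal H_k$, $Z(z)=\sum z_kP_k$. It realizes $S$ if $S(z)=D+C(I-Z(z)A)^{-1}Z(z)B$; it is compatible with $\{K_k\}$ if $K_k(z,w)=\Gamma_k(z)\Gamma_k(w)^*$ with $\Gamma_k(z)=\begin{bmatrix}C(I-Z(z)A)^{-1}\\ z_k^{-1}B^*(I-Z(z)^{-1}A^*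 )^{-1}\end{bmatrix}P_k$ (formal expansions). Unitary equivalence: a unitary map of state spaces intertwining the projections $P_k$ and the colligation operators (identity on $\mathcal E,\mathcal E_*$). $U$ is closely connected if $\mathcal H$ is the smallest closed subspace containing $\operatorname{im}B$ and $\operatorname{im}C^*$ and invariant under $A,A^*,P_1,\dots,P_d$. $U$ is strictly closely connected if the map $h\mapsto\begin{bmatrix}C(I-Z(z)A)^{-1}h\\ B^*(I-Z(z)^{-1}A^* )^{-1}Z(z)^{-1}h\end{bmatrix}\in(\mathcal E_*\oplus\mathcal E)[[z^{\pm1}]]$ is injective on $\mathcal H$. **Scattering minimality.** A trajectory of $U$ is a function $n\mapsto(u(n),x(n),y(n))\in\mathcal E\times\mathcal H\times\mathcal E_*$ on $\mathbb Z^d$ with $P_kx(n+\mathbf e_k)=P_k(Ax(n)+Bu(n))$ for all $k$ and $y(n)=Cx(n)+Du(n)$. It is admissible if $\sum_{n_1+\cdots+n_d\ge0}\|u(n)\|^2+\sum_{n_1+\cdots+n_d=0}\|x(n)\|^2+\sum_{n_1+\cdots+n_d<0}\|y(n)\|^2<\infty$. $U$ is scattering minimal if the associated scattering system on the Hilbert space of admissible trajectories is minimal, i.e., the only admissible trajectory of the form $(0,x(\cdot),0)$ is the zero trajectory. *)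

(* Defs.v *)
From HB Require Import structures.
From mathcomp Require Import all_boot all_order all_algebra sesquilinear.
From mathcomp Require Import finmap complex.
From mathcomp Require Import all_classical all_reals all_analysis.
From mathcomp Require Import ring.
From mathcomp Require summability.
Set Implicit Arguments.
Unset Strict Implicit.
Unset Printing Implicit Defensive.
Import Order.TTheory GRing.Theory Num.Theory.
Import numFieldNormedType.Exports.
Local Open Scope classical_set_scope.
Local Open Scope ring_scope.

HB.mixin Record NormedModule_hasInner (R : realType) H
    & NormedModule R[i] H := {
  inner : {dot H for @Num.conj R[i]};
  innerxx : forall x : H, inner x x = `|x| ^+ 2 }.

#[short(type="preHilbertType")]
HB.structure Definition PreHilbert (R : realType) :=
  {H of NormedModule R[i] H & NormedModule_hasInner R H}.

#[short(type="hilbertType")]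
HB.structure Definition Hilbert (R : realType) :=
  {H of CompleteNormedModule R[i] H & NormedModule_hasInner R H}.

HB.factory Record Lmodule_isPreHilbert (R : realType) H & GRing.Lmodule R[i] H := {
  inner : {dot H for @Num.conj R[i]} }.

HB.builders Context R H & Lmodule_isPreHilbert R H.

Let ip : H -> H -> R[i] := inner.

Let ip_ge0 x : 0 <= ip x x.
Proof.
have [->|x0] := eqVneq x 0; first by rewrite /ip linear0l.
exact/ltW/neq0_dnorm_gt0.
Qed.

Let ipC x y : (ip x y)^* = ip y x.
Proof. by rewrite /ip [RHS](hermitian_subproof y x) expr0 mul1r. Qed.

Let CauchySchwarz x y : `|ip x y| ^+ 2 <= ip x x * ip y y.
Proof.
have [->|y0] := eqVneq y 0; first by rewrite /ip !linear0r normr0 expr0n.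
have yy : 0 < ip y y by exact: neq0_dnorm_gt0.
set a := ip x y / ip y y.
have ipZr c u v : ip u (c *: v) = c^* * ip u v by exact: linearr_subproof.
have ipZl c u v : ip (c *: u) v = c * ip u v by exact: linearl_subproof.
have ipBr u v w : ip u (v - w) = ip u v - ip u w by exact: linearBr.
have ipBl u v w : ip (u - v) w = ip u w - ip v w by exact: linearBl.
have := ip_ge0 (x - a *: y).
have <- : (ip x x * ip y y - `|ip x y| ^+ 2) / ip y y =
          ip (x - a *: y) (x - a *: y).
  have aC : a^* = ip y x / ip y y by rewrite rmorphM fmorphV /= !ipC.
  rewrite ipBl !ipBr !ipZl !ipZr aC normCK ipC /a.
  by field; rewrite gt_eqF.
by rewrite pmulr_lge0 ?invr_gt0// subr_ge0.
Qed.

Let nrm x := sqrtC (ip x x).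

Let nrm_ge0 x : 0 <= nrm x. Proof. by rewrite sqrtC_ge0. Qed.

Let nrmK x : nrm x ^+ 2 = ip x x. Proof. exact: sqrtCK. Qed.

Let nrmD x y : nrm (x + y) <= nrm x + nrm y.
Proof.
rewrite -(@ler_pXn2r _ 2) ?nnegrE ?addr_ge0//.
have ipDr u v w : ip u (v + w) = ip u v + ip u w by exact: linearDr.
have ipDl u v w : ip (u + v) w = ip u w + ip v w by exact: linearDl.
rewrite sqrrD !nrmK ipDl !ipDr -addrA -addrA lerD2l addrA lerD2r.
rewrite -[ip y x]ipC.
have rl : ip x y + (ip x y)^* \is Num.real.
  by rewrite CrealE rmorphD /= conjCK addrC.
apply: (le_trans (real_ler_norm rl)); apply: (le_trans (ler_normD _ _)).
rewrite norm_conjC -mulr2n ler_wMn2r//.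
rewrite -(@ler_pXn2r _ 2) ?nnegrE ?mulr_ge0//.
by rewrite exprMn !nrmK.
Qed.

Let nrmZ (l : R[i]) x : nrm (l *: x) = `|l| * nrm x.
Proof.
apply/eqP; rewrite -(@eqrXn2 _ 2) ?mulr_ge0//; apply/eqP.
have ipZr c u v : ip u (c *: v) = c^* * ip u v by exact: linearr_subproof.
have ipZl c u v : ip (c *: u) v = c * ip u v by exact: linearl_subproof.
by rewrite exprMn !nrmK normCK ipZl ipZr mulrA.
Qed.

Let nrm0_eq0 x : nrm x = 0 -> x = 0.
Proof.
move=> /(congr1 (fun r => r ^+ 2)); rewrite nrmK expr0n => xx.
have [//|x0] := eqVneq x 0.
have : 0 < ip x x by exact: neq0_dnorm_gt0.
by rewrite xx ltxx.
Qed.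

HB.instance Definition _ := Lmodule_isNormed.Build R[i] H nrmD nrmZ nrm0_eq0.

Let innerxx (x : H) : inner x x = `|x| ^+ 2. Proof. by rewrite nrmK. Qed.

HB.instance Definition _ := NormedModule_hasInner.Build R H innerxx.

HB.end.

Definition hsum (R : realType) (H1 H2 : hilbertType R) : Type := (H1 * H2)%type.

Section hsum.
Variables (R : realType) (H1 H2 : hilbertType R).

HB.instance Definition _ := GRing.Lmodule.copy (hsum H1 H2) (H1 * H2)%type.

Definition hsum_inner (x y : hsum H1 H2) : R[i] :=
  inner x.1 y.1 + inner x.2 y.2.

Let hsum_innerDl y : zmod_morphism (hsum_inner^~ y).
Proof. by move=> u v; rewrite /hsum_inner/= !linearBl addrACA opprD. Qed.

Let hsum_innerDr x : zmod_morphism (hsum_inner x).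
Proof. by move=> u v; rewrite /hsum_inner/= !linearBr addrACA opprD. Qed.

Let hsum_innerZl y : scalable_for *%R (hsum_inner^~ y).
Proof.
move=> a u; rewrite /hsum_inner/= mulrDr; congr (_ + _);
  exact: linearl_subproof.
Qed.

Let hsum_innerZr x : scalable_for (@Num.conj R[i] \; *%R) (hsum_inner x).
Proof.
move=> a u; rewrite /hsum_inner/= mulrDr; congr (_ + _);
  exact: linearr_subproof.
Qed.

HB.instance Definition _ := isBilinear.Build R[i] (hsum H1 H2) (hsum H1 H2) R[i]
  *%R (@Num.conj R[i] \; *%R) hsum_inner
  hsum_innerDl hsum_innerDr hsum_innerZl hsum_innerZr.

Let hsum_innerC x y : hsum_inner x y = (-1) ^+ false * (hsum_inner y x)^*.
Proof.
rewrite expr0 mul1r /hsum_inner rmorphD/=.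
by congr (_ + _); rewrite [LHS]hermitian_subproof expr0 mul1r.
Qed.

HB.instance Definition _ := isHermitianSesquilinear.Build R[i] (hsum H1 H2)
  false (@Num.conj R[i]) hsum_inner hsum_innerC.

Let hsum_inner_gt0 x : x != 0 -> 0 < hsum_inner x x.
Proof.
move=> x0; rewrite /hsum_inner !innerxx lt_def addr_ge0 ?exprn_ge0// andbT.
rewrite paddr_eq0 ?exprn_ge0// !expf_eq0/= !normr_eq0.
by apply: contra x0 => /andP[/eqP a /eqP b]; apply/eqP; rewrite [x]surjective_pairing a b.
Qed.

HB.instance Definition _ := isDotProduct.Build R[i] (hsum H1 H2) hsum_inner
  hsum_inner_gt0.

HB.instance Definition _ := Lmodule_isPreHilbert.Build R (hsum H1 H2) hsum_inner.

Lemma hsum_normE (x : hsum H1 H2) : `|x| ^+ 2 = `|x.1| ^+ 2 + `|x.2| ^+ 2.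
Proof. by rewrite -!innerxx. Qed.

Let norm_fst (x : hsum H1 H2) : `|x.1| <= `|x|.
Proof.
by rewrite -(@ler_pXn2r _ 2) ?nnegrE// hsum_normE lerDl exprn_ge0.
Qed.

Let norm_snd (x : hsum H1 H2) : `|x.2| <= `|x|.
Proof.
by rewrite -(@ler_pXn2r _ 2) ?nnegrE// hsum_normE lerDr exprn_ge0.
Qed.

Let norm_hsum (x : hsum H1 H2) : `|x| <= `|x.1| + `|x.2|.
Proof.
rewrite -(@ler_pXn2r _ 2) ?nnegrE ?addr_ge0// hsum_normE sqrrD.
by rewrite addrAC lerDl mulrn_wge0// mulr_ge0.
Qed.

Let hsum_complete (F : set_system (hsum H1 H2)) :
  ProperFilter F -> cauchy F -> cvg F.
Proof.
move=> FF Fc.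
have proj (H : hilbertType R) (p : hsum H1 H2 -> H) :
    (forall x y, `|p x - p y| <= `|x - y|) -> cvg (p @ F).
  move=> pn; apply: cauchy_cvg; apply/cauchy_ballP => e e0.
  have /cauchy_ballP/(_ e e0) := Fc.
  rewrite !near_simpl -ball_normE => -[[A B] /= [FA FB] AB].
  exists (p @` A, p @` B) => /=.
    by split; [apply: filterS FA|apply: filterS FB]; exact: preimage_image.
  move=> [_ _] /= [[x Ax <-] [y By <-]]; rewrite -ball_normE; apply: le_lt_trans (pn _ _) _.
  exact: (AB (x, y)).
have /cvg_ex[l1 Fl1] := proj H1 fst (fun x y => norm_fst (x - y)).
have /cvg_ex[l2 Fl2] := proj H2 snd (fun x y => norm_snd (x - y)).
apply/cvg_ex; exists ((l1, l2) : hsum H1 H2); apply/cvgrPdist_lt => e e0.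
have e20 : 0 < e / 2 by rewrite divr_gt0.
move/cvgrPdist_lt/(_ _ e20): Fl1 => Fl1; move/cvgrPdist_lt/(_ _ e20): Fl2 => Fl2.
near=> x; apply: le_lt_trans (norm_hsum _) _.
by rewrite [e]splitr ltrD//=; [near: x; exact: Fl1|near: x; exact: Fl2].
Unshelve. all: by end_near. Qed.

HB.instance Definition _ := Uniform_isComplete.Build (hsum H1 H2) hsum_complete.

End hsum.

Section operators.
Variable R : realType.

Definition rnorm (H : hilbertType R) (x : H) : R := complex.Re `|x|.

Definition bounded_op (H1 H2 : hilbertType R) (f : H1 -> H2) :=
  linear f /\ continuous f.

(* the norm of a bounded operator; junk if f is not bounded *)
Definition opnorm (H1 H2 : hilbertType R) (f : H1 -> H2) : R :=
  sup [set rnorm (f x) | x in [set x : H1 | rnorm x <= 1]].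

(* The Hilbert space adjoint: it exists and is unique for a bounded f; the
   value is 0 for a function without adjoint. *)
Definition adj (H1 H2 : hilbertType R) (f : H1 -> H2) : H2 -> H1 :=
  xget (fun=> 0) [set g | forall x y, inner (f x) y = inner x (g y)].

Definition is_subspace (H : hilbertType R) (M : set H) :=
  M 0 /\ forall (a : R[i]) x y, M x -> M y -> M (a *: x + y).

Definition unitary_op (H1 H2 : hilbertType R) (U : H1 -> H2) :=
  [/\ linear U, forall x y, inner (U x) (U y) = inner x y
    & forall y, exists x, U x = y].

Definition orthogonal_projection (H : hilbertType R) (P : H -> H) :=
  [/\ bounded_op P, forall x, P (P x) = P x
    & forall x y, inner (P x) y = inner x (P y)].

(* [t] exhibits [T] as the Hilbert space tensor product of [H1] and [H2]. *)
Definition is_tensor (H1 H2 T : hilbertType R) (t : {bilinear H1 -> H2 -> T}) :=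
  (forall x y x' y', inner (t x y) (t x' y') = inner x x' * inner y y') /\
  closure [set w | exists s : seq (H1 * H2), w = \sum_(p <- s) t p.1 p.2] = setT.

(* unconditional convergence in norm: the net of finite partial sums *)
Definition has_sum (J : choiceType) (H : hilbertType R) (x : J -> H) (y : H) :=
  summability.partial_sum x @ summability.totally --> y.

End operators.

Section lattice.
Variable d : nat.
Implicit Types (n : 'rV[int]_d) (k : 'I_d) (Om : set 'rV[int]_d).

Definition degree n : int := \sum_k n 0 k.

Definition nonneg n := [forall k, 0 <= n 0 k].

Definition shift_invariant Om := forall k n, Om n -> Om (n + 'e_k).

Definition line n k : set 'rV[int]_d := [set n + 'e_k *~ t | t in setT].

Definition bdry_fin Om k : set 'rV[int]_d :=
  [set n | Om n /\ forall t : int, Om (n + 'e_k *~ t) -> 0 <= t].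

(* A line parallel to the k-th axis is represented by its unique point with
   vanishing k-th coordinate; for such n, the monomial z^n does not
   involve z_k. *)
Definition bdry_pinf Om k : set 'rV[int]_d :=
  [set n : 'rV[int]_d | n 0 k = 0 /\ line n k `&` Om = set0].

Definition bdry_minf Om k : set 'rV[int]_d :=
  [set n : 'rV[int]_d | n 0 k = 0 /\ line n k `<=` Om].

End lattice.

Section series_kernels.
Variables (R : realType) (d : nat).
Local Notation Zd := 'rV[int]_d.

(* the coefficients f_n of the formal Laurent series \sum_n f_n z^n *)
Definition fseries (G : Type) := Zd -> G.

(* the coefficients K_{n,m} of \sum_{n,m} K_{n,m} z^n w^{-m}; adjoints
   follow the convention (z^n)^* = z^{-n} *)
Definition fkernel (G : Type) := Zd -> Zd -> G -> G.

Definition positive_kernel (G : hilbertType R) (K : fkernel G) :=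
  (forall n m, bounded_op (K n m)) /\
  forall (s : seq Zd) (u : Zd -> G), uniq s ->
    0 <= \sum_(n <- s) \sum_(m <- s) inner (K n m (u m)) (u n).

(* H(z) H(w)^* *)
Definition factor_kernel (X G : hilbertType R) (H : Zd -> X -> G) : fkernel G :=
  fun n m => H n \o adj (H m).

(* z^a K(z,w) w^{-a} *)
Definition shift_kernel (G : Type) (a : Zd) (K : fkernel G) : fkernel G :=
  fun n m => K (n - a) (m - a).

(* [coef : H -> G[[z^{+-1}]]] realizes [H] as the formal reproducing kernel
   Hilbert space of K *)
Definition is_rkhs (G : hilbertType R) (K : fkernel G) (H : hilbertType R)
    (coef : H -> fseries G) :=
  [/\ forall n, linear (fun f => coef f n), injective coef
    & forall m u, exists2 Kmu : H, coef Kmu = (fun n => K n m u)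
        & forall f, inner f Kmu = inner (coef f m) u].

(* The elements of the external Hilbert direct sum of the H(K_j), j in D, are
   the square summable families; the overlapping space consists of those whose
   sum is the zero series. *)
Definition trivial_overlapping (G : hilbertType R) (J : choiceType) (D : set J)
    (K : J -> fkernel G) :=
  forall (H : J -> hilbertType R) (coef : forall j, H j -> fseries G),
    (forall j, D j -> is_rkhs (K j) (coef j)) ->
    forall f : forall j, H j,
      (forall j, ~ D j -> f j = 0) ->
      (\esum_(j in D) ((rnorm (f j)) ^+ 2)%:E < +oo)%E ->
      (forall n, has_sum (fun j : D => coef (val j) (f (val j)) n) 0) ->
      forall j, f j = 0.

End series_kernels.

Section schur_agler.
Variables (R : realType) (d : nat) (E Es : hilbertType R).
Local Notation Zd := 'rV[int]_d.

(* T^n, used for n in Z_+^d and commuting T_k *)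
Definition op_monomial (X : hilbertType R) (T : 'I_d -> X -> X) (n : Zd) : X -> X :=
  \big[(fun f g : X -> X => f \o g)/id]_(k < d) iter `|(n 0 k)%R|%N (T k).

Definition schur_agler (S : Zd -> E -> Es) :=
  [/\ forall n, bounded_op (S n),
      forall n, ~~ nonneg n -> forall u, S n u = 0,
      forall z : 'I_d -> R[i], (forall k, `|z k| < 1) ->
        (\esum_(n in [set n : Zd | nonneg n])
          (opnorm (S n) * \prod_k complex.Re `|z k| ^ (n 0 k))%:E < +oo)%E
    & forall (X : hilbertType R) (T : 'I_d -> X -> X),
        (forall k, bounded_op (T k) /\ opnorm (T k) < 1) ->
        (forall j k x, T j (T k x) = T k (T j x)) ->
      forall (EX EsX : hilbertType R)
             (t : {bilinear E -> X -> EX}) (ts : {bilinear Es -> X -> EsX}),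
        is_tensor t -> is_tensor ts ->
        exists ST : EX -> EsX,
          [/\ bounded_op ST,
              forall e x, has_sum (fun n : Zd => ts (S n e) (op_monomial T n x))
                                  (ST (t e x))
            & opnorm ST <= 1]].

(* coefficient of z^n w^{-m} in
     [ I - S(z)S(w)^*     S(w) - S(z)      ]
     [ S(z)^* - S(w)^*    S(z)^*S(w) - I   ];
   the coefficients of z^n in S(z)^* and of w^{-m} in S(w) are S_{-n}^*
   and S_{-m} *)
Definition agler_lhs (S : Zd -> E -> Es) : fkernel d (hsum Es E) :=
  fun n m v =>
    ( v.1 *+ ((n == 0) && (m == 0)) - S n (adj (S m) v.1)
        + (S (- m) v.2 *+ (n == 0) - S n v.2 *+ (m == 0)),
      adj (S (- n)) v.1 *+ (m == 0) - adj (S m) v.1 *+ (n == 0)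
        + (adj (S (- n)) (S (- m) v.2) - v.2 *+ ((n == 0) && (m == 0))) ).

Definition aug_agler_decomposition (S : Zd -> E -> Es)
    (K : 'I_d -> fkernel d (hsum Es E)) :=
  [/\ forall k, positive_kernel (K k),
      forall k, exists (X : hilbertType R) (H : Zd -> X -> hsum Es E),
        [/\ forall n, bounded_op (H n),
            K k = factor_kernel H,
            forall n, ~~ nonneg n -> forall x, (H n x).1 = 0
          & forall n, ~~ nonneg (- n - 'e_k) -> forall x, (H n x).2 = 0]
    & agler_lhs S = fun n m v =>
        \sum_k (K k n m v - shift_kernel 'e_k (K k) n m v)].

Definition scc_decomposition (K : 'I_d -> fkernel d (hsum Es E)) :=
  trivial_overlapping setT K /\
  trivial_overlapping setT (fun k => shift_kernel 'e_k (K k)).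

(* [ 0 0 ; 0 K^22_{+oo,k} ] *)
Definition kernel_pinf (k : 'I_d) (K : fkernel d (hsum Es E)) : fkernel d (hsum Es E) :=
  fun n m v =>
    (0, lim ((fun t : nat =>
          (K (n - 'e_k *+ t) (m - 'e_k *+ t) (0, v.2)).2) @ \oo)).

(* [ K^11_{-oo,k} 0 ; 0 0 ] *)
Definition kernel_minf (k : 'I_d) (K : fkernel d (hsum Es E)) : fkernel d (hsum Es E) :=
  fun n m v =>
    (lim ((fun t : nat =>
          (K (n + 'e_k *+ t) (m + 'e_k *+ t) (v.1, 0)).1) @ \oo), 0).

Definition bdry_index : choiceType :=
  (('I_d * Zd) + (('I_d * Zd) + ('I_d * Zd)))%type.

Definition bdry_set (Om : set Zd) : set bdry_index := fun j =>
  match j with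
  | inl (k, n) => bdry_fin Om k n
  | inr (inl (k, n)) => bdry_pinf Om k n
  | inr (inr (k, n)) => bdry_minf Om k n
  end.

Definition bdry_family (K : 'I_d -> fkernel d (hsum Es E)) (j : bdry_index) :
    fkernel d (hsum Es E) :=
  match j with
  | inl (k, n) => shift_kernel n (K k)
  | inr (inl (k, n)) => shift_kernel n (kernel_pinf k (K k))
  | inr (inr (k, n)) => shift_kernel n (kernel_minf k (K k))
  end.

Definition minimal_decomposition (K : 'I_d -> fkernel d (hsum Es E)) :=
  scc_decomposition K /\
  forall Om : set Zd, shift_invariant Om ->
    trivial_overlapping (bdry_set Om) (bdry_family K).

End schur_agler.

Section colligations.
Variables (R : realType) (d : nat) (E Es : hilbertType R).
Local Notation Zd := 'rV[int]_d.

Record colligation := Colligation {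
  state : hilbertType R;
  cproj : 'I_d -> state -> state;
  coll_op :> hsum state E -> hsum state Es }.

(* H = H_1 + ... + H_d is given as an internal orthogonal direct sum, through
   the projections P_k onto the H_k *)
Definition GR_unitary (U : colligation) :=
  [/\ forall k, orthogonal_projection (@cproj U k),
      forall j k, j != k -> forall x, cproj j (@cproj U k x) = 0,
      forall x, \sum_k @cproj U k x = x
    & unitary_op U].

Section one_colligation.
Variable U : colligation.
Local Notation H := (state U).
Local Notation P := (@cproj U).

Definition opA (x : H) : H := (U (x, 0)).1.
Definition opB (u : E) : H := (U (0, u)).1.
Definition opC (x : H) : Es := (U (x, 0)).2.
Definition opD (u : E) : Es := (U (0, u)).2.

(* the coefficient of z^n in (\sum_k z_k Q_k)^N *)
Fixpoint pencil_pow (Q : 'I_d -> H -> H) (N : nat) (n : Zd) : H -> H :=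
  if N is N'.+1 then fun x => \sum_k Q k (pencil_pow Q N' (n - 'e_k) x)
  else fun x => if n == 0 then x else 0.

(* The coefficient of z^n in (I - \sum_k z_k Q_k)^{-1} = \sum_N (\sum_k z_k Q_k)^N.
   Only N = degree n contributes; pencil_pow Q N n = 0 if N != degree n,
   so that the value is 0 when degree n < 0. *)
Definition resolvent (Q : 'I_d -> H -> H) (n : Zd) : H -> H :=
  pencil_pow Q `|degree n|%N n.

(* (I - Z(z) A)^{-1} *)
Definition resA : Zd -> H -> H := resolvent (fun k => P k \o opA).

(* (I - Z(z)^{-1} A^* )^{-1}, a series in z^{-1} *)
Definition resAadj (n : Zd) : H -> H :=
  resolvent (fun k => P k \o adj opA) (- n).

Definition realizes (S : Zd -> E -> Es) :=
  forall n u, S n u = opD u *+ (n == 0)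
                      + opC (\sum_k resA (n - 'e_k) (P k (opB u))).

Definition Gamma (k : 'I_d) (n : Zd) (x : H) : hsum Es E :=
  (opC (resA n (P k x)), adj opB (resAadj (n + 'e_k) (P k x))).

Definition compatible (K : 'I_d -> fkernel d (hsum Es E)) :=
  forall k, K k = factor_kernel (Gamma k).

Definition closely_connected :=
  forall M : set H, closed M -> is_subspace M ->
    (forall u, M (opB u)) -> (forall y, M (adj opC y)) ->
    (forall x, M x -> M (opA x)) -> (forall x, M x -> M (adj opA x)) ->
    (forall k x, M x -> M (P k x)) ->
    M = setT.

Definition strictly_closely_connected :=
  injective (fun (x : H) (n : Zd) =>
    (opC (resA n x), adj opB (\sum_k resAadj (n + 'e_k) (P k x))) : hsum Es E).

Definition trajectory (u : Zd -> E) (x : Zd -> H) (y : Zd -> Es) :=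
  (forall n k, P k (x (n + 'e_k)) = P k (opA (x n) + opB (u n))) /\
  (forall n, y n = opC (x n) + opD (u n)).

Definition admissible (u : Zd -> E) (x : Zd -> H) (y : Zd -> Es) :=
  (\esum_(n in [set n : Zd | (0 <= degree n)%R]) (rnorm (u n) ^+ 2)%:E +
   \esum_(n in [set n : Zd | degree n = 0%R]) (rnorm (x n) ^+ 2)%:E +
   \esum_(n in [set n : Zd | (degree n < 0)%R]) (rnorm (y n) ^+ 2)%:E < +oo)%E.

Definition scattering_minimal :=
  forall x : Zd -> H,
    trajectory (fun=> 0) x (fun=> 0) -> admissible (fun=> 0) x (fun=> 0) ->
    x = fun=> 0.

End one_colligation.

Definition unitarily_equivalent (U U' : colligation) :=
  exists W : state U -> state U',
    [/\ unitary_op W,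
        forall k x, W (cproj k x) = cproj k (W x)
      & forall x u, U' (W x, u) = (W (U (x, u)).1, (U (x, u)).2)].

End colligations.

(* Main.v *)
Require Import Defs.
From HB Require Import structures.
From mathcomp Require Import all_boot all_order all_algebra sesquilinear.
From mathcomp Require Import finmap complex.
From mathcomp Require Import all_classical all_reals all_analysis.
From mathcomp Require Import ring lra.
Set Implicit Arguments.
Unset Strict Implicit.
Unset Printing Implicit Defensive.
Import Order.TTheory GRing.Theory Num.Theory.
Import numFieldNormedType.Exports.
Local Open Scope classical_set_scope.
Local Open Scope ring_scope.

(** The augmented Agler decomposition says that, with [alpha(z)] and [beta(z)] the
    columns with entries [I, S(z)^*] and [S(z), I],
    [F(z) F(w)^* + beta(z) beta(w)^* = F'(z) F'(w)^* + alpha(z) alpha(w)^*],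
    where [F] is the row of the factors [F_k] of the kernels [K_k], and [F'] the
    row of the [z_k F_k]. Equality of the two sides is equality of two Gram
    matrices, and defines an isometry between the spans of the ranges of the
    adjoints. When [F_k] acts on the reproducing kernel space of [K_k], the
    triviality of the two overlapping spaces says that the coefficients of [F],
    and those of [F'], separate the points of the direct sum [H] of these spaces;
    together with the supports of [alpha], [beta] and of the components of [F_k]
    it makes the two spans dense. So the isometry is a unitary [U] from [H + E]
    to [H + E_*] ([gram_unitary]). The adjoint of its defining property is
    [F(z) x + beta(z) u = F'(z) x' + alpha(z) y] for [U (x, u) = (x', y)]. Read
    componentwise it gives recursions whose solutions are the resolvents
    ([resolvent_unique]), so that [F_k = Gamma_k] and [U] realizes [S]: this is
    [exists_colligation].

    Conversely, every GR-unitary realization satisfies this identity with [F_k = Gamma_k]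
    ([transfer]). The vectors that all the [Gamma_k] annihilate form a subspace;
    modulo it, the overlapping conditions let the sums [Gamma_sum] and
    [Gamma_shift] separate points, and then the transfer identity shows that the
    subspace is invariant under [A] and [A^*] and is killed by [C] and [B^*]. Close
    connectedness makes it trivial ([hidden_trivial]), which is strict close
    connectedness. For two such colligations the adjoints of the [Gamma_k] have
    equal Gram matrices, given by the kernels, and total ranges; the resulting
    unitary map is the unitary equivalence.

    For scattering minimality the half space of the points of nonnegative degree
    is a shift-invariant sublattice, whose finite boundaries are all equal to the
    hyperplane of degree [0] and which has no infinite boundary. Given an
    admissible trajectory [(0, x, 0)], the square summable family of the
    [P_k x(n)], [n] of degree [0], sums to the series with coefficients [C x(m)]
    in degrees at least [0] and [B^* A x(m)] in negative degrees, because the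
    coefficients of the resolvents propagate the values on the hyperplane
    ([finsum_resolvent]). Both vanish along the trajectory, so by minimality
    [x] vanishes on the hyperplane, hence everywhere. *)

(** * Inner products and the projection theorem *)
Section inner_product.
Variables (R : realType) (H : hilbertType R).
Implicit Types (x y z : H) (a : R[i]).

Lemma innerDl x y z : inner (x + y) z = inner x z + inner y z.
Proof. exact: linearDl. Qed.
Lemma innerDr x y z : inner z (x + y) = inner z x + inner z y.
Proof. exact: linearDr. Qed.
Lemma innerBl x y z : inner (x - y) z = inner x z - inner y z.
Proof. exact: linearBl. Qed.
Lemma innerBr x y z : inner z (x - y) = inner z x - inner z y.
Proof. exact: linearBr. Qed.
Lemma innerNl x z : inner (- x) z = - inner x z.
Proof. exact: linearNl. Qed.
Lemma innerNr x z : inner z (- x) = - inner z x.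
Proof. exact: linearNr. Qed.
Lemma inner0l z : inner 0 z = 0.
Proof. exact: linear0l. Qed.
Lemma inner0r z : inner z 0 = 0.
Proof. exact: linear0r. Qed.
Lemma innerZl a x z : inner (a *: x) z = a * inner x z.
Proof. exact: linearl_subproof. Qed.
Lemma innerZr a x z : inner z (a *: x) = a^* * inner z x.
Proof. exact: linearr_subproof. Qed.
Lemma innerC x y : inner x y = (inner y x)^*.
Proof. by rewrite [LHS]hermitian_subproof expr0 mul1r. Qed.
Lemma inner_suml I r (P : pred I) (F : I -> H) z :
  inner (\sum_(i <- r | P i) F i) z = \sum_(i <- r | P i) inner (F i) z.
Proof. exact: (linear_sumlz (inner (s := H))). Qed.
Lemma inner_sumr I r (P : pred I) (F : I -> H) z :
  inner z (\sum_(i <- r | P i) F i) = \sum_(i <- r | P i) inner z (F i).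
Proof. exact: linear_sumr. Qed.

Lemma inner_eq0 x : inner x x = 0 -> x = 0.
Proof.
by rewrite innerxx => /eqP; rewrite expf_eq0 /= normr_eq0 => /eqP.
Qed.

Lemma inner_inj x y : (forall z, inner x z = inner y z) -> x = y.
Proof.
move=> h; apply/eqP; rewrite -subr_eq0; apply/eqP/inner_eq0.
by rewrite innerBl h subrr.
Qed.

Lemma inner_injr x y : (forall z, inner z x = inner z y) -> x = y.
Proof. by move=> h; apply: inner_inj => z; rewrite innerC h -innerC. Qed.

End inner_product.

Section norm.
Variables (R : realType) (H : hilbertType R).
Implicit Types (x y z : H) (a : R[i]).

Lemma inner_ge0 x : 0 <= inner x x.
Proof. by rewrite innerxx exprn_ge0. Qed.

Lemma rnormE x : (rnorm x)%:C%C = `|x|.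
Proof. by rewrite /rnorm RRe_real // ger0_real. Qed.

Lemma rnorm_ge0 x : 0 <= rnorm x.
Proof. by rewrite -lecR rnormE; exact: normr_ge0. Qed.

Lemma rnorm_sqE x : (rnorm x ^+ 2)%:C%C = inner x x.
Proof. by rewrite rmorphXn /= rnormE innerxx. Qed.

Lemma cauchy_schwarz x y : `|inner x y| <= `|x| * `|y|.
Proof.
rewrite -(@ler_pXn2r _ 2) ?nnegrE ?mulr_ge0// exprMn -!innerxx.
have [->|y0] := eqVneq y 0; first by rewrite !inner0r normr0 expr0n mulr0.
have yy : 0 < inner y y by rewrite innerxx exprn_gt0 // normr_gt0.
set a := inner x y / inner y y.
have := inner_ge0 (x - a *: y).
have <- : (inner x x * inner y y - `|inner x y| ^+ 2) / inner y y =
          inner (x - a *: y) (x - a *: y).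
  have aC : a^* = inner y x / inner y y.
    by rewrite rmorphM fmorphV /= -!innerC.
  rewrite innerBl !innerBr !innerZl !innerZr aC normCK -innerC /a.
  by field; rewrite ?gt_eqF ?normr_gt0.
by rewrite pmulr_lge0 ?invr_gt0// subr_ge0.
Qed.

(** Continuity of the inner product, in the only form needed: orthogonality to
    [z] passes to limits. *)
Lemma inner_approx_eq0 y z :
  (forall e : R[i], 0 < e -> exists2 x, `|x - y| < e & inner x z = 0) ->
  inner y z = 0.
Proof.
move=> h; apply/eqP; apply: contraT => ne.
have n0 : 0 < `|inner y z| by rewrite normr_gt0.
have z1 : 0 < `|z| + 1 by rewrite ltr_wpDl.
have [x xy xz] := h (`|inner y z| / (`|z| + 1)) (divr_gt0 n0 z1).
have e : inner y z = - inner (x - y) z by rewrite innerBl xz sub0r opprK.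
have := cauchy_schwarz (x - y) z.
have -> : `|inner (x - y) z| = `|inner y z| by rewrite e normrN.
move: xy; rewrite ltr_pdivlMr // => xy /le_lt_trans.
suff : `|x - y| * `|z| <= `|x - y| * (`|z| + 1).
  by move=> l /(_ _ (le_lt_trans l xy)); rewrite ltxx.
by rewrite ler_wpM2l // lerDl.
Qed.

End norm.

Section projection.
Variables (R : realType) (H : hilbertType R).

(** It bounds the distance of two almost minimizers of the distance to [x], since
    their midpoint cannot do better than the infimum. *)
Lemma parallelogram (x m m' : H) :
  rnorm (m - m') ^+ 2 = 2 * rnorm (x - m) ^+ 2 + 2 * rnorm (x - m') ^+ 2
      - 4 * rnorm (x - 2^-1 *: (m + m')) ^+ 2.
Proof.
apply: complexI.
have -> : forall a b c : R, (2 * a + 2 * b - 4 * c)%:C%C =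
    2 * a%:C%C + 2 * b%:C%C - 4 * c%:C%C.
  by move=> a b c; rewrite rmorphB rmorphD !rmorphM /= !rmorph_nat.
rewrite !rnorm_sqE !(innerBl, innerBr, innerDl, innerDr, innerZl, innerZr).
have -> : (2^-1 : R[i])^* = 2^-1 by rewrite fmorphV rmorph_nat.
by field.
Qed.

(** The best correction of [y] along the line of [v]; near a minimizer of the
    distance the gain must be small, so [y] is almost orthogonal to [v]. *)
Lemma rnorm_perturb (y v : H) : v != 0 ->
  rnorm (y - (inner y v / inner v v) *: v) ^+ 2 =
  rnorm y ^+ 2 - (complex.Re `|inner y v|) ^+ 2 / rnorm v ^+ 2.
Proof.
move=> v0; have vv : inner v v != 0.
  by apply: contra v0 => /eqP/inner_eq0 ->.
apply: complexI.
have -> : forall a b c : R, (a - b ^+ 2 / c)%:C%C =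
    a%:C%C - b%:C%C ^+ 2 / c%:C%C.
  by move=> a b c; rewrite rmorphB rmorphM fmorphV rmorphXn.
rewrite RRe_real ?ger0_real // !rnorm_sqE normCK -innerC.
rewrite !(innerBl, innerBr, innerDl, innerDr, innerZl, innerZr).
have -> : (inner y v / inner v v)^* = inner v y / inner v v.
  by rewrite rmorphM fmorphV /= -!innerC.
by field.
Qed.

(** The sets of almost minimizers of the distance from [x] to [M] generate a
    Cauchy filter by the parallelogram law; its limit is the projection. *)
Theorem projection (M : set H) : closed M -> is_subspace M ->
  forall x, exists2 m, M m & forall v, M v -> inner (x - m) v = 0.
Proof.
move=> cM [M0 Ml] x.
have Mhalf m m' : M m -> M m' -> M (2^-1 *: (m + m')).
  move=> Mm Mm'; rewrite -[X in M X]addr0; apply: (Ml) => //.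
  by rewrite -[m]scale1r; apply: Ml.
pose D := [set rnorm (x - m) ^+ 2 | m in M].
have Dlb : lbound D 0 by move=> _ [m _ <-]; rewrite exprn_ge0 ?rnorm_ge0.
have hD : has_inf D by split; [exists (rnorm (x - 0) ^+ 2), 0 | exists 0].
pose dd := inf D.
have ddlb m : M m -> dd <= rnorm (x - m) ^+ 2.
  by move=> Mm; apply: (ge_inf (proj2 hD)); exists m.
pose A e := [set m | M m /\ rnorm (x - m) ^+ 2 < dd + e].
have A0 e : 0 < e -> A e !=set0.
  move=> e0; have [_ [m Mm <-] lt] := inf_adherent e0 hD.
  by exists m.
pose F := filter_from [set e : R | 0 < e] A.
have FF : ProperFilter F.
  apply: filter_from_proper => //; apply: filter_from_filter.
    by exists 1 => /=.
  move=> e1 e2 /= e10 e20; exists (Num.min e1 e2) => /=.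
    by rewrite lt_min e10.
  move=> m [Mm lt]; split; split=> //; apply: (lt_le_trans lt);
    by rewrite lerD2l ge_min lexx ?orbT.
have Fc : cauchy F.
  apply/cauchy_ballP => e e0.
  have ee : (complex.Re e)%:C%C = e by rewrite RRe_real // gtr0_real.
  have e'0 : 0 < complex.Re e by rewrite -ltcR ee.
  exists (A (complex.Re e ^+ 2 / 4), A (complex.Re e ^+ 2 / 4)) => /=.
    by split; exists (complex.Re e ^+ 2 / 4) => //=;
      rewrite divr_gt0 ?exprn_gt0.
  move=> [m m'] /= [[Mm lm] [Mm' lm']].
  rewrite -ball_normE /= -rnormE -ee ltcR.
  rewrite -(@ltr_pXn2r _ 2) ?nnegrE ?rnorm_ge0 //; last exact: ltW.
  rewrite (parallelogram x); have := ddlb _ (Mhalf _ _ Mm Mm').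
  move: lm lm'; set u := complex.Re e ^+ 2; clearbody u; lra.
have /cvg_ex[m Fm] : cvg F by exact: cauchy_cvg.
have near (e : R[i]) (r : R) : 0 < e -> 0 < r ->
    exists2 p, A r p & `|m - p| < e.
  move=> e0 r0; have Fe : F (ball m e) := Fm _ (nbhsx_ballx m e e0).
  have FA : F (A r) by exists r.
  have [p [Ap]] := filter_ex (filterI FA Fe).
  by rewrite -ball_normE; exists p.
exists m.
  apply: cM => B /nbhs_ballP[e /= e0 eB].
  have [p [Mp _] mp] := near e 1 e0 ltr01.
  by exists p; split => //; apply: eB; rewrite -ball_normE.
move=> v Mv; have [->|v0] := eqVneq v 0; first by rewrite inner0r.
have v'0 : 0 < rnorm v by rewrite -ltcR rnormE normr_gt0.
have key p r : A r p -> (complex.Re `|inner (x - p) v|) ^+ 2 <= r * rnorm v ^+ 2.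
  move=> [Mp lp]; rewrite -ler_pdivrMr ?exprn_gt0 //.
  set a := inner (x - p) v / inner v v.
  have := ddlb _ (Ml a v p Mv Mp).
  rewrite opprD addrA addrAC rnorm_perturb //.
  move: lp; set u := _ / _; set w := rnorm _ ^+ 2; clearbody u w; lra.
apply/eqP; apply: contraT => ne.
have n0 : 0 < `|inner (x - m) v| by rewrite normr_gt0.
set c := complex.Re `|inner (x - m) v|.
have cE : c%:C%C = `|inner (x - m) v| by rewrite RRe_real // gtr0_real.
have c0 : 0 < c by rewrite -ltcR cE.
have e0 : 0 < `|inner (x - m) v| / (2 * `|v|).
  by rewrite divr_gt0 // mulr_gt0 // normr_gt0.
have r0 : 0 < c ^+ 2 / (4 * rnorm v ^+ 2) by rewrite divr_gt0 ?mulr_gt0 ?exprn_gt0.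
have [p /key kp mp] := near _ _ e0 r0.
have pE : (complex.Re `|inner (x - p) v|)%:C%C = `|inner (x - p) v|.
  by rewrite RRe_real // ger0_real.
have : complex.Re `|inner (x - p) v| <= c / 2.
  have c20 : 0 <= c / 2 by rewrite divr_ge0 // ltW.
  have p0 : 0 <= complex.Re `|inner (x - p) v|.
    by rewrite -lecR pE; exact: normr_ge0.
  rewrite -(@ler_pXn2r _ 2) ?nnegrE //.
  apply: (le_trans kp); rewrite le_eqVlt; apply/orP; left; apply/eqP.
  by field; rewrite gt_eqF.
rewrite -lecR pE => kk.
have : `|inner (x - m) v| <= `|inner (x - p) v| + `|m - p| * `|v|.
  have -> : inner (x - m) v = inner (x - p) v - inner (m - p) v.
    by rewrite !innerBl; ring.
  by apply: (le_trans (ler_normB _ _)); rewrite lerD2l cauchy_schwarz.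
have lt2 : `|m - p| * `|v| < (c / 2)%:C%C.
  move: mp; rewrite ltr_pdivlMr ?mulr_gt0 ?normr_gt0 // => mp.
  rewrite rmorphM fmorphV /= rmorph_nat cE ltr_pdivlMr //.
  by move: mp; rewrite mulrCA mulrC.
move=> /le_lt_trans/(_ (ler_ltD kk lt2)).
by rewrite -rmorphD /= -splitr cE ltxx.
Qed.

(** [perp A] is automatically a closed subspace, so stating the projection
    theorem for it spares the side conditions. *)
Definition perp (A : set H) : set H := [set x | forall a, A a -> inner x a = 0].

Lemma perp_subspace A : is_subspace (perp A).
Proof.
split=> [a _|a x y px py b Ab]; first exact: inner0l.
by rewrite innerDl innerZl px // py // mulr0 addr0.
Qed.

Lemma perp_closed A : closed (perp A).
Proof.
move=> y cy a Aa; apply: inner_approx_eq0 => e e0.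
have [x [px yx]] := cy _ (nbhsx_ballx y e e0).
by exists x; [rewrite distrC; move: yx; rewrite -ball_normE | exact: px].
Qed.

Lemma perp_projection A x : exists2 m, perp A m & perp (perp A) (x - m).
Proof.
have [m pm h] := projection (perp_closed (A := A)) (perp_subspace A) x.
by exists m.
Qed.

End projection.

(** * Adjoints *)
Section adjoints.
Variables (R : realType) (H1 H2 : hilbertType R).

Definition adjoint (f : H1 -> H2) (g : H2 -> H1) :=
  forall x y, inner (f x) y = inner x (g y).

(** [adj] is a choice among all adjoints, so exhibiting one computes it. *)
Lemma adjointE f g : adjoint f g -> adj f = g.
Proof.
move=> fg; apply/funext => y; apply: inner_injr => x.
rewrite -fg /adj; case: xgetP => [h _ hh|]; first by rewrite -hh.
by move=> /(_ g) /(_ fg).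
Qed.

Lemma closed_fiber0 (f : H1 -> H2) y : continuous f ->
  closed [set x | inner (f x) y = 0].
Proof.
move=> cf x cx; apply: inner_approx_eq0 => e e0.
have [x' [/= x'0 fx']] := cx _ (cf x _ (nbhsx_ballx (f x) e e0)).
by exists (f x') => //; rewrite distrC; move: fx'; rewrite -ball_normE.
Qed.

(** Riesz representation: a continuous functional vanishes on a closed hyperplane
    and is the inner product with a multiple of a normal vector [z]. *)
Lemma adjP f : bounded_op f -> adjoint f (adj f).
Proof.
move=> [lf cf].
have fZ a x : f (a *: x) = a *: f x.
  have f0 : f 0 = 0 by have := lf (-1) 0 0; rewrite !scaleN1r !addNr.
  by have := lf a x 0; rewrite f0 !addr0.
have fB x x' : f (x - x') = f x - f x'.
  by have := lf (-1) x' x; rewrite !scaleN1r addrC [X in f X = _]addrC => ->; rewrite addrC.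
suff riesz y : exists w, forall x, inner (f x) y = inner x w.
  have /choice[g fg] := riesz.
  have agp : adjoint f g by move=> x y; exact: fg.
  by rewrite (adjointE agp).
have [h0|/existsNP[x0 /eqP n0]] := pselect (forall x, inner (f x) y = 0).
  by exists 0 => x; rewrite h0 inner0r.
pose M := [set x | inner (f x) y = 0].
have sM : is_subspace M.
  split=> [|a u v /= Mu Mv]; first by rewrite /M /= -[0](scale0r 0) fZ scale0r inner0l.
  by rewrite /M /= lf innerDl innerZl Mu Mv mulr0 addr0.
have [m Mm zM] := projection (closed_fiber0 (y := y) cf) sM x0.
set z := x0 - m in zM.
have fz : inner (f z) y != 0 by rewrite fB innerBl Mm subr0.
have z0 : inner z z != 0.
  apply: contra fz => /eqP/inner_eq0 ->.
  by rewrite -[0](scale0r 0) fZ scale0r inner0l.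
exists ((inner (f z) y / inner z z)^* *: z) => x.
have : inner z (x - (inner (f x) y / inner (f z) y) *: z) = 0.
  apply: zM; rewrite /M /= fB fZ innerBl innerZl divfK ?subrr //.
move/eqP; rewrite innerC conjC_eq0 innerBl innerZl subr_eq0 => /eqP e.
by rewrite innerZr conjCK e; field; apply/andP.
Qed.

Lemma adjoint_linear f g : adjoint f g -> linear f.
Proof.
move=> fg a x y; apply: inner_inj => z.
by rewrite innerDl innerZl !fg innerDl innerZl.
Qed.

Lemma unitary_adjoint U : unitary_op U -> exists V : H2 -> H1,
  [/\ adjoint U V, cancel U V & cancel V U].
Proof.
move=> [lU iU sU]; have /choice[V UV] := sU.
have UVK : cancel V U by [].
exists V; split => // [x y|x]; first by rewrite -{1}(UV y) iU.
apply: inner_inj => z; rewrite -iU UV; by [].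
Qed.

End adjoints.

Lemma adjointC (R : realType) (H1 H2 : hilbertType R) (f : H1 -> H2) g :
  adjoint f g -> adjoint g f.
Proof. by move=> fg x y; rewrite innerC -fg -innerC. Qed.

(** * Subspaces and finite direct sums as Hilbert spaces *)
(** Every closed subspace is of the form [perp A]; encoding it so makes membership
    a family of equations, which pass to limits. *)
Definition orthsub (R : realType) (H : hilbertType R) (A : set H) : Type :=
  {x : H | `[< perp A x >]}.

Section orthsub.
Variables (R : realType) (H : hilbertType R) (A : set H).
Local Notation S := (orthsub A).

Definition perpb : pred H := fun x => `[< perp A x >].

Let perp_submod : submod_closed perpb.
Proof.
have [p0 pl] := perp_subspace A.
by split=> [|a x y /asboolP px /asboolP py]; apply/asboolP => //; apply: pl.
Qed.

HB.instance Definition _ := [isSub of S for @sval H perpb].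
HB.instance Definition _ := [Choice of S by <:].
HB.instance Definition _ :=
  GRing.SubChoice_isSubLmodule.Build R[i] H perpb S perp_submod.

Definition orthsub_inner (x y : S) : R[i] := inner (val x) (val y).

Let valB (x y : S) : val (x - y) = val x - val y. Proof. exact: raddfB. Qed.
Let valZ a (x : S) : val (a *: x) = a *: val x. Proof. exact: linearZ. Qed.

Let inner_Bl y : zmod_morphism (orthsub_inner^~ y).
Proof. by move=> u v; rewrite /orthsub_inner valB innerBl. Qed.

Let inner_Br x : zmod_morphism (orthsub_inner x).
Proof. by move=> u v; rewrite /orthsub_inner valB innerBr. Qed.

Let inner_Zl y : scalable_for *%R (orthsub_inner^~ y).
Proof. by move=> a u; rewrite /orthsub_inner valZ innerZl. Qed.

Let inner_Zr x : scalable_for (@Num.conj R[i] \; *%R) (orthsub_inner x).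
Proof. by move=> a u; rewrite /orthsub_inner valZ innerZr. Qed.

HB.instance Definition _ := isBilinear.Build R[i] S S R[i]
  *%R (@Num.conj R[i] \; *%R) orthsub_inner
  inner_Bl inner_Br inner_Zl inner_Zr.

Let inner_C x y : orthsub_inner x y = (-1) ^+ false * (orthsub_inner y x)^*.
Proof. by rewrite expr0 mul1r; exact: innerC. Qed.

HB.instance Definition _ := isHermitianSesquilinear.Build R[i] S
  false (@Num.conj R[i]) orthsub_inner inner_C.

Let inner_gt0 x : x != 0 -> 0 < orthsub_inner x x.
Proof.
move=> x0; rewrite /orthsub_inner innerxx exprn_gt0 // normr_gt0.
by apply: contra x0 => /eqP v0; apply/eqP/val_inj; rewrite v0.
Qed.

HB.instance Definition _ := isDotProduct.Build R[i] S orthsub_inner inner_gt0.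

HB.instance Definition _ := Lmodule_isPreHilbert.Build R S orthsub_inner.

Lemma orthsub_norm (x : S) : `|x| = `|val x|.
Proof. by apply/eqP; rewrite -(@eqrXn2 _ 2) // -!innerxx. Qed.

Let orthsub_complete (F : set_system S) : ProperFilter F -> cauchy F -> cvg F.
Proof.
move=> FF Fc.
have /cvg_ex[l Fl] : cvg (val @ F).
  apply: cauchy_cvg; apply/cauchy_ballP => e e0.
  have /cauchy_ballP/(_ e e0) := Fc.
  rewrite !near_simpl -ball_normE => -[[B C] /= [FB FC] BC].
  exists (val @` B, val @` C) => /=.
    by split; [apply: filterS FB|apply: filterS FC]; exact: preimage_image.
  move=> [_ _] /= [[x Bx <-] [y Cy <-]]; rewrite -ball_normE /=.
  by have := BC (x, y); rewrite /= orthsub_norm valB; apply.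
have pl : perp A l.
  apply: perp_closed => B /Fl FB; have [x Bx] := filter_ex (FB : F _).
  by exists (val x); split => //; exact/asboolP/(valP x).
apply/cvg_ex; exists (Sub l (asboolT pl) : S).
apply/cvgrPdist_lt => e e0; move/cvgrPdist_lt/(_ _ e0): Fl.
by apply: filterS => x; rewrite orthsub_norm valB SubK.
Qed.

HB.instance Definition _ := Uniform_isComplete.Build S orthsub_complete.

Lemma orthsub_innerE (x y : S) : inner x y = inner (val x) (val y).
Proof. by []. Qed.

Definition Orthsub x (px : perp A x) : S := Sub x (asboolT px).

Lemma orthsubP (x : S) : perp A (val x).
Proof. exact/asboolP/(valP x). Qed.

End orthsub.

Definition dsum (R : realType) (I : finType) (Y : I -> hilbertType R) : Type :=
  forall i, Y i.

Section dsum.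
Variables (R : realType) (I : finType) (Y : I -> hilbertType R).
Local Notation S := (dsum Y).
Implicit Types x y : S.

HB.instance Definition _ := gen_eqMixin S.
HB.instance Definition _ := gen_choiceMixin S.

Let add x y : S := fun i => x i + y i.
Let opp x : S := fun i => - x i.
Let zero : S := fun i => 0.
Let scale (a : R[i]) x : S := fun i => a *: x i.

Let addA : associative add.
Proof. by move=> x y z; apply/functional_extensionality_dep => i; exact: addrA. Qed.
Let addC : commutative add.
Proof. by move=> x y; apply/functional_extensionality_dep => i; exact: addrC. Qed.
Let add0 : left_id zero add.
Proof. by move=> x; apply/functional_extensionality_dep => i; exact: add0r. Qed.
Let addN : left_inverse zero opp add.
Proof. by move=> x; apply/functional_extensionality_dep => i; exact: addNr. Qed.

HB.instance Definition _ := GRing.isZmodule.Build S addA addC add0 addN.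

Let scaleA a b x : scale a (scale b x) = scale (a * b) x.
Proof. by apply/functional_extensionality_dep => i; exact: scalerA. Qed.
Let scale1 : left_id 1 scale.
Proof. by move=> x; apply/functional_extensionality_dep => i; exact: scale1r. Qed.
Let scaleDr : right_distributive scale +%R.
Proof. by move=> a x y; apply/functional_extensionality_dep => i; exact: scalerDr. Qed.
Let scaleDl x : {morph scale^~ x : a b / a + b}.
Proof. by move=> a b; apply/functional_extensionality_dep => i; exact: scalerDl. Qed.

HB.instance Definition _ :=
  GRing.Zmodule_isLmodule.Build R[i] S scaleA scale1 scaleDr scaleDl.

Definition dsum_inner x y : R[i] := \sum_i inner (x i) (y i).

Let inner_Bl y : zmod_morphism (dsum_inner^~ y).
Proof.
by move=> u v; rewrite /dsum_inner -sumrB; apply: eq_bigr => i _; exact: innerBl.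
Qed.

Let inner_Br x : zmod_morphism (dsum_inner x).
Proof.
by move=> u v; rewrite /dsum_inner -sumrB; apply: eq_bigr => i _; exact: innerBr.
Qed.

Let inner_Zl y : scalable_for *%R (dsum_inner^~ y).
Proof.
by move=> a u; rewrite /dsum_inner mulr_sumr; apply: eq_bigr => i _; exact: innerZl.
Qed.

Let inner_Zr x : scalable_for (@Num.conj R[i] \; *%R) (dsum_inner x).
Proof.
by move=> a u; rewrite /dsum_inner /= mulr_sumr; apply: eq_bigr => i _; exact: innerZr.
Qed.

HB.instance Definition _ := isBilinear.Build R[i] S S R[i]
  *%R (@Num.conj R[i] \; *%R) dsum_inner inner_Bl inner_Br inner_Zl inner_Zr.

Let inner_C x y : dsum_inner x y = (-1) ^+ false * (dsum_inner y x)^*.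
Proof.
by rewrite expr0 mul1r /dsum_inner rmorph_sum; apply: eq_bigr => i _; exact: innerC.
Qed.

HB.instance Definition _ := isHermitianSesquilinear.Build R[i] S
  false (@Num.conj R[i]) dsum_inner inner_C.

Let inner_gt0 x : x != 0 -> 0 < dsum_inner x x.
Proof.
move=> x0; rewrite lt_def; apply/andP; split; last first.
  by apply: sumr_ge0 => i _; exact: inner_ge0.
apply: contra x0 => /eqP s0; apply/eqP/functional_extensionality_dep => i.
apply: inner_eq0; move: s0 => /eqP; rewrite psumr_eq0 => [|j _]; last exact: inner_ge0.
by move=> /allP/(_ i (mem_index_enum i))/eqP.
Qed.

HB.instance Definition _ := isDotProduct.Build R[i] S dsum_inner inner_gt0.

HB.instance Definition _ := Lmodule_isPreHilbert.Build R S dsum_inner.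

Lemma dsum_innerE x y : inner x y = \sum_i inner (x i) (y i).
Proof. by []. Qed.

Let norm_component x i : `|x i| <= `|x|.
Proof.
rewrite -(@ler_pXn2r _ 2) ?nnegrE// -!innerxx dsum_innerE (bigD1 i) //= lerDl.
by apply: sumr_ge0 => j _; exact: inner_ge0.
Qed.

Let norm_dsum x : `|x| <= \sum_i `|x i|.
Proof.
rewrite -(@ler_pXn2r _ 2) ?nnegrE ?sumr_ge0// -innerxx dsum_innerE expr2 mulr_suml.
apply: ler_sum => i _; rewrite innerxx expr2 ler_wpM2l //.
by rewrite (bigD1 i) //= lerDl sumr_ge0.
Qed.

Let dsum_complete (F : set_system S) : ProperFilter F -> cauchy F -> cvg F.
Proof.
move=> FF Fc.
have proj i : exists l : Y i, (fun x : S => x i) @ F --> l.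
  apply/cvg_ex; apply: cauchy_cvg; apply/cauchy_ballP => e e0.
  have /cauchy_ballP/(_ e e0) := Fc.
  rewrite !near_simpl -ball_normE => -[[A B] /= [FA FB] AB].
  exists ((fun x : S => x i) @` A, (fun x : S => x i) @` B) => /=.
    by split; [apply: filterS FA|apply: filterS FB]; exact: preimage_image.
  move=> [_ _] /= [[x Ax <-] [y By <-]]; rewrite -ball_normE.
  by apply: le_lt_trans (norm_component (x - y) i) _; exact: (AB (x, y)).
pose l : S := fun i => projT1 (cid (proj i)).
have Fl i : (fun x : S => x i) @ F --> l i by rewrite /l; case: cid.
apply/cvg_ex; exists l; apply/cvgrPdist_lt => e e0.
have e'0 : 0 < e / (#|I|.+1%:R) by rewrite divr_gt0.
have near_all : \forall x \near F, forall i, i \in enum I ->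
    `|l i - x i| < e / (#|I|.+1%:R).
  elim: (enum I) => [|i s IH]; first exact: nearW.
  move/cvgrPdist_lt/(_ _ e'0): (Fl i) => Fi.
  apply: filterS2 Fi IH => x xi xs j; rewrite inE => /orP[/eqP ->|js] //.
  exact: xs.
apply: filterS near_all => x xl; apply: le_lt_trans (norm_dsum _) _.
apply: (@le_lt_trans _ _ (\sum_(i : I) e / (#|I|.+1%:R))).
  by apply: ler_sum => i _; apply/ltW/xl; rewrite mem_enum.
rewrite sumr_const -[ltRHS](@divfK _ (#|I|.+1%:R)) ?pnatr_eq0 //.
by rewrite -[ltLHS]mulr_natr ltr_pM2l // ltr_nat.
Qed.

HB.instance Definition _ := Uniform_isComplete.Build S dsum_complete.

Definition dsum_proj (k : I) (x : S) : S := fun i => if i == k then x i else 0.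

Lemma dsum_sum J (r : seq J) (P : pred J) (f : J -> S) i :
  (\sum_(j <- r | P j) f j) i = \sum_(j <- r | P j) f j i.
Proof. by elim/big_rec2: _ => // j _ y _ <-. Qed.

End dsum.

(** * Families with equal Gram matrices *)
Section gram.
Variables (R : realType) (H1 H2 : hilbertType R) (I : Type).
Variables (a : I -> H1) (b : I -> H2).

Definition total_family (H : hilbertType R) (c : I -> H) :=
  forall x, (forall i, inner x (c i) = 0) -> x = 0.

(** The lurking isometry argument, without any extension by continuity. The graph
    of [W] is the set [G1] of the pairs [(x, y)] with [<x, a_i> = <y, b_i>] for
    all [i]; totality makes [G1] coincide with the closed span [G] of the
    pairs [(a_i, b_i)], on which the two coordinates have the same inner
    products, and the projection of [(x, 0)] on [G] is half of the point
    above [x]. *)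
Theorem gram_unitary : total_family a -> total_family b ->
  (forall i j, inner (a i) (a j) = inner (b i) (b j)) ->
  exists2 W : H1 -> H2, unitary_op W & forall i, W (a i) = b i.
Proof.
move=> ta tb ab.
pose T : set (hsum H1 H2) := [set (a i, b i) | i in setT].
pose G := perp (perp T).
pose G1 (x : H1) (y : H2) := forall i, inner x (a i) = inner y (b i).
have inE (p q : hsum H1 H2) : inner p q = inner p.1 q.1 + inner p.2 q.2 by [].
have TT p q : perp T (p, q) <-> G1 p (- q).
  split=> [h i|h _ [i _ <-]]; last by rewrite inE /= h innerNl addNr.
  have : inner ((p, q) : hsum H1 H2) (a i, b i) = 0 by apply: h; exists i.
  by rewrite inE /= innerNl => /eqP; rewrite addr_eq0 => /eqP.
have GG1 x y : G (x, y) -> G1 x y.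
  move=> Gxy i; have : perp T (a i, - b i) by apply/TT => j; rewrite opprK.
  move=> /Gxy; rewrite inE /= innerNr => /eqP; rewrite subr_eq0 => /eqP //.
have TG m : perp (perp (perp T)) m -> perp T m.
  by move=> pm t Tt; apply: pm => w Tw; rewrite innerC Tw // conjC0.
have G1D x y x' y' : G1 x y -> G1 x' y' -> G1 (x + x') (y + y').
  by move=> h h' i; rewrite !innerDl h h'.
have G1Z c x y : G1 x y -> G1 (c *: x) (c *: y).
  by move=> h i; rewrite !innerZl h.
have G1N x y : G1 x y -> G1 (- x) (- y).
  by move=> /(G1Z (-1)); rewrite !scaleN1r.
have G1G x y : G1 x y -> G (x, y).
  move=> Gxy; have [[p q] Gpq /TG/TT/= h2] := perp_projection (perp T) (x, y).
  have h1 := G1D _ _ _ _ Gxy (G1N _ _ (GG1 _ _ Gpq)).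
  have q0 : y - q = 0.
    apply: tb => i; have := h2 i; rewrite (h1 i) innerNl => /eqP.
    by rewrite -addr_eq0 -mulr2n mulrn_eq0 /= => /eqP.
  have p0 : x - p = 0 by apply: ta => i; rewrite h1 q0 inner0l.
  by move/eqP: q0; move/eqP: p0; rewrite !subr_eq0 => /eqP -> /eqP ->.
have iso x y x' y' : G1 x y -> G1 x' y' -> inner x x' = inner y y'.
  move=> /G1G Gxy h'; have : perp T (x', - y') by apply/TT; rewrite opprK.
  by move=> /Gxy; rewrite inE /= innerNr => /eqP; rewrite subr_eq0 => /eqP.
have G1uniq x y y' : G1 x y -> G1 x y' -> y = y'.
  move=> h /G1N/(G1D _ _ _ _ h) h'; apply/eqP; rewrite -subr_eq0.
  by apply/eqP/tb => i; rewrite -h' subrr inner0l.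
have ex x : exists y, G1 x y.
  have [[p q] /GG1 Gpq /TG/TT/= h] := perp_projection (perp T) (x, 0).
  exists (q + q); have -> : x = p + (x - p) by rewrite addrC subrK.
  by apply: G1D => //; move: h; rewrite opprB subr0.
have sur y : exists x, G1 x y.
  have [[p q] /GG1 Gpq /TG/TT/= /G1N h] := perp_projection (perp T) (0, y).
  exists (p + p); have -> : y = q + (y - q) by rewrite addrC subrK.
  by apply: G1D => //; move: h; rewrite !opprB subr0.
have /choice[W GW] := ex.
exists W; last by move=> i; apply: (G1uniq (a i)) => // j.
split=> [c x y|x y|y].
- by apply: (G1uniq (c *: x + y)) => //; apply/G1D => //; apply: G1Z.
- exact/esym/iso.
- by have [x xy] := sur y; exists x; apply: (G1uniq x).
Qed.

End gram.

(** * Resolvents of operator pencils *)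
Section linear_maps.
Variables (K : pzRingType) (U V : lmodType K) (f : U -> V).
Hypothesis lf : linear f.

Lemma lin0 : f 0 = 0.
Proof. by have := lf (-1) 0 0; rewrite !scaleN1r !addNr. Qed.
Lemma linZ a x : f (a *: x) = a *: f x.
Proof. by have := lf a x 0; rewrite lin0 !addr0. Qed.
Lemma linD x y : f (x + y) = f x + f y.
Proof. by have := lf 1 x y; rewrite !scale1r. Qed.
Lemma linN x : f (- x) = - f x.
Proof. by rewrite -scaleN1r linZ scaleN1r. Qed.
Lemma linB x y : f (x - y) = f x - f y.
Proof. by rewrite linD linN. Qed.
Lemma lin_sum I (r : seq I) (P : pred I) (F : I -> U) :
  f (\sum_(i <- r | P i) F i) = \sum_(i <- r | P i) f (F i).
Proof. exact: (big_morph f linD lin0). Qed.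

End linear_maps.

Section lattice_points.
Variable d : nat.
Implicit Types (n m : 'rV[int]_d) (k : 'I_d).

Lemma degreeD n m : degree (n + m) = degree n + degree m.
Proof. by rewrite /degree -big_split; apply: eq_bigr => k _; rewrite mxE. Qed.

Lemma degreeN n : degree (- n) = - degree n.
Proof. by rewrite /degree -sumrN; apply: eq_bigr => k _; rewrite mxE. Qed.

Lemma degree0 : degree (0 : 'rV[int]_d) = 0.
Proof. by rewrite /degree big1 // => k _; rewrite mxE. Qed.

Lemma degree_e k : degree ('e_k : 'rV[int]_d) = 1.
Proof.
rewrite /degree (bigD1 k) //= big1 => [|j jk]; first by rewrite mxE !eqxx.
by rewrite mxE eqxx (negPf jk).
Qed.

Lemma degreeBe n k : degree (n - 'e_k) = degree n - 1.
Proof. by rewrite degreeD degreeN degree_e. Qed.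

Lemma degreeDe n k : degree (n + 'e_k) = degree n + 1.
Proof. by rewrite degreeD degree_e. Qed.

Lemma nonneg0 : nonneg (0 : 'rV[int]_d).
Proof. by apply/forallP => k; rewrite mxE. Qed.

Lemma nonneg_degree n : nonneg n -> 0 <= degree n.
Proof. by move=> /forallP h; apply: sumr_ge0. Qed.

Lemma degree_nonneg n : degree n < 0 -> ~~ nonneg n.
Proof. by move=> h; apply/negP => /nonneg_degree; rewrite leNgt h. Qed.

Lemma nonnegDe n k : nonneg n -> nonneg (n + 'e_k).
Proof.
by move=> /forallP h; apply/forallP => j; rewrite !mxE addr_ge0 // ler0n.
Qed.

Lemma nonnegBe n k : ~~ nonneg n -> ~~ nonneg (n - 'e_k).
Proof. by apply: contra => /(nonnegDe k); rewrite subrK. Qed.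

End lattice_points.

Section resolvents.
Variables (R : realType) (d : nat) (E Es : hilbertType R) (U : colligation d E Es).
Local Notation H := (state U).
Implicit Types (Q : 'I_d -> H -> H) (n : 'rV[int]_d) (k : 'I_d) (x : H).

Lemma pencil_pow_supp Q N n x : (forall k, Q k 0 = 0) ->
  ~~ (nonneg n && (degree n == N%:Z)) -> pencil_pow Q N n x = 0.
Proof.
move=> Q0; elim: N n => [|N IH] n /=.
  by have [->|//] := eqVneq n 0; rewrite nonneg0 degree0.
move=> h; rewrite big1 // => k _; rewrite IH //; apply: contra h.
move=> /andP[/(nonnegDe k)]; rewrite subrK degreeBe => -> /=.
by rewrite subr_eq -PoszD addn1.
Qed.

(** The definition peels words from the left; this peels them from the right. *)
Lemma pencil_powSr Q N n x : (forall k, linear (Q k)) ->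
  pencil_pow Q N.+1 n x = \sum_k pencil_pow Q N (n - 'e_k) (Q k x).
Proof.
move=> lQ; elim: N n => [|N IH] n.
  by apply: eq_bigr => k _ /=; case: eqVneq => // _; rewrite (lin0 (lQ k)).
rewrite [LHS]/=; under eq_bigr => k _ do rewrite -/(pencil_pow Q N.+1 _ _) IH lin_sum //.
by rewrite exchange_big; apply: eq_bigr => k _; apply: eq_bigr => j _; rewrite addrAC.
Qed.

Lemma resolventE Q N n : degree n = N%:Z -> resolvent Q n = pencil_pow Q N n.
Proof. by rewrite /resolvent => ->. Qed.

Lemma resolvent_supp Q n x : (forall k, linear (Q k)) ->
  ~~ nonneg n -> resolvent Q n x = 0.
Proof.
by move=> lQ h; apply: pencil_pow_supp => [k|]; rewrite ?(negPf h) // (lin0 (lQ k)).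
Qed.

Lemma resolvent0 Q x : resolvent Q 0 x = x.
Proof. by rewrite (resolventE _ (degree0 d)) /= eqxx. Qed.

Lemma resolvent_rec Q n x : (forall k, linear (Q k)) ->
  resolvent Q n x = x *+ (n == 0) + \sum_k Q k (resolvent Q (n - 'e_k) x).
Proof.
move=> lQ; have [nn|nn] := boolP (nonneg n); last first.
  rewrite resolvent_supp // big1 => [|k _]; last first.
    by rewrite resolvent_supp ?nonnegBe // (lin0 (lQ k)).
  by case: eqVneq nn => [->|]; rewrite ?nonneg0 // addr0.
have := nonneg_degree nn; case Nn: (degree n) => [[|N]|] // _.
  rewrite big1 => [|k _]; last first.
    by rewrite resolvent_supp ?(lin0 (lQ k)) // degree_nonneg // degreeBe Nn.
  by rewrite (resolventE _ Nn) /= addr0; case: eqP.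
have /negPf -> : n != 0 by apply/eqP => n0; move: Nn; rewrite n0 degree0.
rewrite (resolventE _ Nn) add0r; apply: eq_bigr => k _.
by rewrite (@resolventE _ N) // degreeBe Nn -addn1 PoszD addrK.
Qed.

Lemma resolvent_recr Q n x : (forall k, linear (Q k)) ->
  resolvent Q n x = x *+ (n == 0) + \sum_k resolvent Q (n - 'e_k) (Q k x).
Proof.
move=> lQ; have [nn|nn] := boolP (nonneg n); last first.
  rewrite resolvent_supp // big1 => [|k _]; last by rewrite resolvent_supp ?nonnegBe.
  by case: eqVneq nn => [->|]; rewrite ?nonneg0 // addr0.
have := nonneg_degree nn; case Nn: (degree n) => [[|N]|] // _.
  rewrite big1 => [|k _]; last first.
    by rewrite resolvent_supp // degree_nonneg // degreeBe Nn.
  by rewrite (resolventE _ Nn) /= addr0; case: eqP.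
have /negPf -> : n != 0 by apply/eqP => n0; move: Nn; rewrite n0 degree0.
rewrite (resolventE _ Nn) add0r pencil_powSr //; apply: eq_bigr => k _.
by rewrite (@resolventE _ N) // degreeBe Nn -addn1 PoszD addrK.
Qed.

Lemma resolvent_adjoint Q Q' n : (forall k, adjoint (Q k) (Q' k)) ->
  adjoint (resolvent Q n) (resolvent Q' n).
Proof.
move=> QQ'; rewrite /resolvent; move: (absz (degree n)) => N; elim: N n => [|N IH] n x y.
  by rewrite /=; case: eqP; rewrite // inner0l inner0r.
rewrite pencil_powSr => [|k]; last exact: adjoint_linear (QQ' k).
rewrite /= inner_suml inner_sumr; apply: eq_bigr => k _.
by rewrite IH QQ'.
Qed.

Lemma resolvent_linear Q n : (forall k, linear (Q k)) -> linear (resolvent Q n).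
Proof.
move=> lQ; rewrite /resolvent; move: (absz (degree n)) => N.
elim: N n => [|N IH] n a x y /=.
  by case: eqP => // _; rewrite scaler0 addr0.
by rewrite scaler_sumr -big_split; apply: eq_bigr => k _ /=; rewrite IH lQ.
Qed.

Lemma resolvent_stable Q (M : set H) n x : is_subspace M ->
  (forall k x, M x -> M (Q k x)) -> M x -> M (resolvent Q n x).
Proof.
move=> [M0 Ml] MQ Mx; rewrite /resolvent; move: (absz (degree n)) => N.
elim: N n => [|N IH] n /=.
  by case: ifP.
apply: (big_ind M) => // [u v Mu Mv|k _]; last exact: MQ.
by rewrite -[u]scale1r; exact: Ml.
Qed.

(** The recursion [F(z) = F(z) Q(z) + c] has [c (I - Q(z))^-1] as its only
    solution among the series with nonnegative support. *)
Lemma resolvent_unique Q (V : lmodType R[i]) (F : 'rV[int]_d -> H -> V) (c : H -> V) :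
  (forall k, linear (Q k)) -> linear c ->
  (forall n x, ~~ nonneg n -> F n x = 0) ->
  (forall n x, F n x = \sum_k F (n - 'e_k) (Q k x) + c x *+ (n == 0)) ->
  forall n x, F n x = c (resolvent Q n x).
Proof.
move=> lQ lc sF rF n x; have [nn|nn] := boolP (nonneg n); last first.
  by rewrite sF // resolvent_supp // (lin0 lc).
have [N] : {N : nat | degree n = N%:Z}.
  by have := nonneg_degree nn; case: (degree n) => // N _; exists N.
elim: N n x nn => [|N IH] n x nn Nn;
  rewrite rF resolvent_recr // (linD lc) (lin_sum lc) addrC; congr (_ + _).
- by case: eqP; rewrite // (lin0 lc).
- apply: eq_bigr => k _.
  have kn : ~~ nonneg (n - 'e_k) by rewrite degree_nonneg // degreeBe Nn.
  by rewrite sF // resolvent_supp // (lin0 lc).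
- by case: eqP; rewrite // (lin0 lc).
apply: eq_bigr => k _; have [kn|kn] := boolP (nonneg (n - 'e_k)).
  by apply: IH => //; rewrite degreeBe Nn -addn1 PoszD addrK.
by rewrite sF // resolvent_supp // (lin0 lc).
Qed.

(** Both sides sum, over the words of a given degree, the alternating products
    that begin and end with a projection. *)
Lemma resolvent_intertwine (P : 'I_d -> H -> H) (T : H -> H) n x :
  (forall k, linear (P k)) -> linear T ->
  \sum_k P k (resolvent (fun k => T \o P k) (n - 'e_k) x) =
  \sum_k resolvent (fun k => P k \o T) (n - 'e_k) (P k x).
Proof.
move=> lP lT; rewrite /resolvent.
under eq_bigr => k _ do rewrite degreeBe; under [RHS]eq_bigr => k _ do rewrite degreeBe.
move: (absz (degree n - 1)) => N; elim: N n => [|N IH] n /=.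
  by apply: eq_bigr => k _; case: eqP => // _; rewrite (lin0 (lP k)).
under eq_bigr => k _.
  rewrite -(lin_sum lT) IH (lin_sum lT) (lin_sum (lP k)).
  under eq_bigr => j _ do rewrite addrAC.
  over.
by rewrite exchange_big.
Qed.

End resolvents.

(** * The identity satisfied by a realization *)
Section hsum_facts.
Variables (R : realType) (H1 H2 : hilbertType R).

Lemma hsum_innerE (p q : hsum H1 H2) : inner p q = inner p.1 q.1 + inner p.2 q.2.
Proof. by []. Qed.

Lemma hsum_eq (p q : hsum H1 H2) : p.1 = q.1 -> p.2 = q.2 -> p = q.
Proof. by case: p q => [? ?] [? ?] /= -> ->. Qed.

Lemma hsum_sum I (r : seq I) (P : pred I) (F : I -> hsum H1 H2) :
  \sum_(i <- r | P i) F i =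
  (\sum_(i <- r | P i) (F i).1, \sum_(i <- r | P i) (F i).2).
Proof. by elim/big_rec3: _ => // i a b c _ ->. Qed.

End hsum_facts.

Section transfer.
Variables (R : realType) (d : nat) (E Es : hilbertType R).
Variable S : 'rV[int]_d -> E -> Es.

(** [alpha(z)] is the column with entries [I] and the adjoint of [S(z)], [beta(z)]
    the column with entries [S(z)] and [I]; [alphaA] and [betaA] are the
    coefficientwise adjoints. *)
Definition alpha n (y : Es) : hsum Es E := (y *+ (n == 0), adj (S (- n)) y).
Definition beta n (u : E) : hsum Es E := (S n u, u *+ (n == 0)).
Definition alphaA n (g : hsum Es E) : Es := g.1 *+ (n == 0) + S (- n) g.2.
Definition betaA n (g : hsum Es E) : E := adj (S n) g.1 + g.2 *+ (n == 0).

Hypothesis bS : forall n, bounded_op (S n).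

Lemma alpha_adjoint n : adjoint (alpha n) (alphaA n).
Proof.
move=> y g; rewrite hsum_innerE /= innerDr; congr (_ + _).
  by case: eqP; rewrite ?inner0l ?inner0r.
by rewrite (adjointC (adjP (bS _))).
Qed.

Lemma beta_adjoint n : adjoint (beta n) (betaA n).
Proof.
move=> u g; rewrite hsum_innerE /= innerDr; congr (_ + _).
  exact: (adjP (bS _)).
by case: eqP; rewrite ?inner0l ?inner0r.
Qed.

(** The left-hand side of the augmented Agler decomposition has the signature
    of a difference of two positive kernels: it is
    [alpha(z) alpha(w)^* - beta(z) beta(w)^*]. *)
Lemma agler_lhsE n m v :
  agler_lhs S n m v = alpha n (alphaA m v) - beta n (betaA m v).
Proof.
have lS k : linear (S k) := (bS k).1.
have lA k : linear (adj (S k)) := adjoint_linear (adjointC (adjP (bS k))).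
apply: hsum_eq; rewrite /= /alphaA /betaA (linD (lS _), linD (lA _));
  case: (n == 0); case: (m == 0); rewrite ?mulr1n ?mulr0n
    ?(lin0 (lS _)) ?(lin0 (lA _)) ?addr0 ?subr0 ?add0r ?sub0r ?subrr ?opprD ?oppr0 ?addr0 //;
  first [by rewrite addrACA | by rewrite addrC].
Qed.

End transfer.

Section colligation_operators.
Variables (R : realType) (d : nat) (E Es : hilbertType R) (U : colligation d E Es).
Local Notation H := (state U).
Local Notation P := (@cproj R d E Es U).
Local Notation Ua := (adj U).
Hypothesis grU : GR_unitary U.

Lemma cproj_linear k : linear (P k).
Proof. by have [/(_ k)[[]]] := grU. Qed.

Lemma cproj_adjoint k : adjoint (P k) (P k).
Proof. by have [/(_ k)[]] := grU. Qed.

Lemma cproj_id k x : P k (P k x) = P k x.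
Proof. by have [/(_ k)[]] := grU. Qed.

Lemma cproj_orth j k x : j != k -> P j (P k x) = 0.
Proof. by move=> jk; have [_ h _ _] := grU; exact: h. Qed.

Lemma cproj_sum x : \sum_k P k x = x.
Proof. by have [_ _ h _] := grU; exact: h. Qed.

Lemma cprojE j k x : P j (P k x) = if j == k then P k x else 0.
Proof. by case: eqVneq => [->|/cproj_orth ->//]; rewrite cproj_id. Qed.

Lemma coll_op_linear : linear U.
Proof. by have [_ _ _ []] := grU. Qed.

Lemma coll_op_adjoint : adjoint U Ua.
Proof.
by have [_ _ _ /unitary_adjoint[V [UV _ _]]] := grU; rewrite (adjointE UV).
Qed.

Lemma coll_opK : cancel U Ua.
Proof.
by have [_ _ _ /unitary_adjoint[V [UV UVK _]]] := grU; rewrite (adjointE UV).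
Qed.

Lemma coll_opKV : cancel Ua U.
Proof.
by have [_ _ _ /unitary_adjoint[V [UV _ UVK]]] := grU; rewrite (adjointE UV).
Qed.

Lemma coll_opE (p : hsum H E) : U p = (opA p.1 + opB U p.2, opC p.1 + opD U p.2).
Proof.
have -> : U p = U (p.1, 0) + U (0, p.2).
  rewrite -(linD coll_op_linear); congr (@coll_op _ _ _ _ U _).
  by apply: hsum_eq; rewrite /= ?addr0 ?add0r.
by [].
Qed.

Let blockl (H1 H2 : hilbertType R) (x : H1) (q : hsum H1 H2) :
  inner x q.1 = inner ((x, 0) : hsum H1 H2) q.
Proof. by rewrite hsum_innerE inner0l addr0. Qed.

Let blockr (H1 H2 : hilbertType R) (x : H2) (q : hsum H1 H2) :
  inner x q.2 = inner ((0, x) : hsum H1 H2) q.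
Proof. by rewrite hsum_innerE inner0l add0r. Qed.

Let blockl' (H1 H2 : hilbertType R) (x : H1) (q : hsum H1 H2) :
  inner q.1 x = inner q ((x, 0) : hsum H1 H2).
Proof. by rewrite hsum_innerE inner0r addr0. Qed.

Let blockr' (H1 H2 : hilbertType R) (x : H2) (q : hsum H1 H2) :
  inner q.2 x = inner q ((0, x) : hsum H1 H2).
Proof. by rewrite hsum_innerE inner0r add0r. Qed.

Let opA_adj : adjoint (@opA _ _ _ _ U) (fun x => (Ua (x, 0)).1).
Proof. by move=> x y; rewrite blockl' blockl coll_op_adjoint. Qed.
Let opB_adj : adjoint (@opB _ _ _ _ U) (fun x => (Ua (x, 0)).2).
Proof. by move=> x y; rewrite blockl' blockr coll_op_adjoint. Qed.
Let opC_adj : adjoint (@opC _ _ _ _ U) (fun y => (Ua (0, y)).1).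
Proof. by move=> x y; rewrite blockr' blockl coll_op_adjoint. Qed.
Let opD_adj : adjoint (@opD _ _ _ _ U) (fun y => (Ua (0, y)).2).
Proof. by move=> x y; rewrite blockr' blockr coll_op_adjoint. Qed.

Lemma opA_adjoint : adjoint (@opA _ _ _ _ U) (adj (@opA _ _ _ _ U)).
Proof. by rewrite (adjointE opA_adj). Qed.
Lemma opB_adjoint : adjoint (@opB _ _ _ _ U) (adj (@opB _ _ _ _ U)).
Proof. by rewrite (adjointE opB_adj). Qed.
Lemma opC_adjoint : adjoint (@opC _ _ _ _ U) (adj (@opC _ _ _ _ U)).
Proof. by rewrite (adjointE opC_adj). Qed.
Lemma opD_adjoint : adjoint (@opD _ _ _ _ U) (adj (@opD _ _ _ _ U)).
Proof. by rewrite (adjointE opD_adj). Qed.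

Definition opA_linear := adjoint_linear opA_adjoint.
Definition opB_linear := adjoint_linear opB_adjoint.
Definition opC_linear := adjoint_linear opC_adjoint.
Definition opD_linear := adjoint_linear opD_adjoint.
Definition adjA_linear := adjoint_linear (adjointC opA_adjoint).
Definition adjB_linear := adjoint_linear (adjointC opB_adjoint).
Definition adjC_linear := adjoint_linear (adjointC opC_adjoint).
Definition adjD_linear := adjoint_linear (adjointC opD_adjoint).

Lemma coll_adjE (p : hsum H Es) :
  Ua p = (adj (@opA _ _ _ _ U) p.1 + adj (@opC _ _ _ _ U) p.2,
          adj (@opB _ _ _ _ U) p.1 + adj (@opD _ _ _ _ U) p.2).
Proof.
have -> : Ua p = Ua (p.1, 0) + Ua (0, p.2).
  rewrite -(linD (adjoint_linear (adjointC coll_op_adjoint))); congr (adj U _).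
  by apply: hsum_eq; rewrite /= ?addr0 ?add0r.
by rewrite (adjointE opA_adj) (adjointE opB_adj) (adjointE opC_adj) (adjointE opD_adj).
Qed.

Lemma PA_linear k : linear (P k \o @opA _ _ _ _ U).
Proof. by move=> a x y; rewrite /= opA_linear cproj_linear. Qed.
Lemma PAadj_linear k : linear (P k \o adj (@opA _ _ _ _ U)).
Proof. by move=> a x y; rewrite /= adjA_linear cproj_linear. Qed.

Lemma resA_linear n : linear (@resA _ _ _ _ U n).
Proof. exact: resolvent_linear PA_linear. Qed.
Lemma resAadj_linear n : linear (@resAadj _ _ _ _ U n).
Proof. exact: resolvent_linear PAadj_linear. Qed.

Lemma resA_adjoint n : adjoint (@resA _ _ _ _ U n)
  (resolvent (fun k => adj (@opA _ _ _ _ U) \o P k) n).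
Proof. by apply: resolvent_adjoint => k x y; rewrite /= cproj_adjoint opA_adjoint. Qed.

Lemma resAadj_adjoint n : adjoint (@resAadj _ _ _ _ U n)
  (resolvent (fun k => @opA _ _ _ _ U \o P k) (- n)).
Proof.
by apply: resolvent_adjoint => k x y; rewrite /= cproj_adjoint (adjointC opA_adjoint).
Qed.

Definition GammaA k n (g : hsum Es E) : H :=
  P k (resolvent (fun k => adj (@opA _ _ _ _ U) \o P k) n (adj (@opC _ _ _ _ U) g.1)
       + resolvent (fun k => @opA _ _ _ _ U \o P k) (- (n + 'e_k)) (opB U g.2)).

Lemma Gamma_adjoint k n : adjoint (@Gamma _ _ _ _ U k n) (GammaA k n).
Proof.
move=> x g; rewrite hsum_innerE /= opC_adjoint resA_adjoint.
by rewrite (adjointC opB_adjoint) resAadj_adjoint -innerDr cproj_adjoint.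
Qed.

Definition Gamma_linear k n := adjoint_linear (@Gamma_adjoint k n).

Lemma Gamma_proj j k n x :
  @Gamma _ _ _ _ U j n (P k x) = if j == k then Gamma k n x else 0.
Proof.
rewrite /Gamma cprojE; case: eqVneq => [->|] //.
rewrite (lin0 (resA_linear _)) (lin0 (resAadj_linear _)).
by rewrite (lin0 opC_linear) (lin0 adjB_linear).
Qed.

(** [Gamma_sum] sums the coefficients of the series [Gamma_k(z)]; [Gamma_shift] sums
    those of [z_k Gamma_k(z)], the factors of the kernels [K'_k]. *)
Definition Gamma_sum n (x : H) : hsum Es E := \sum_k Gamma k n x.
Definition Gamma_shift n (x : H) : hsum Es E := \sum_k Gamma k (n - 'e_k) x.

Lemma Gamma_sumE n x : Gamma_sum n x =
  (opC (resA n x), adj (@opB _ _ _ _ U) (\sum_k resAadj (n + 'e_k) (P k x))).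
Proof.
rewrite /Gamma_sum hsum_sum /=; congr (_, _).
  rewrite -(lin_sum opC_linear) -(lin_sum (resA_linear n)).
  by rewrite cproj_sum.
by rewrite (lin_sum adjB_linear).
Qed.

Lemma Gamma_shiftE n x : Gamma_shift n x =
  (opC (\sum_k resA (n - 'e_k) (P k x)), adj (@opB _ _ _ _ U) (resAadj n x)).
Proof.
rewrite /Gamma_shift hsum_sum /=; congr (_, _); first by rewrite (lin_sum opC_linear).
under eq_bigr => k _ do rewrite subrK.
by rewrite -(lin_sum adjB_linear) -(lin_sum (resAadj_linear n)) cproj_sum.
Qed.

Variable S : 'rV[int]_d -> E -> Es.
Hypothesis rS : realizes U S.

(** The resolvents of [Z A] and of its adjoint differ by the side on which the
    projections act; [resolvent_intertwine] exchanges the sides. *)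
Lemma realized_adj n y : adj (S (- n)) y =
  adj (@opB _ _ _ _ U) (\sum_k resAadj (n + 'e_k) (P k (adj (@opC _ _ _ _ U) y)))
  + adj (@opD _ _ _ _ U) y *+ (n == 0).
Proof.
suff adjS : adjoint (S (- n)) (fun y =>
    adj (@opB _ _ _ _ U) (\sum_k resAadj (n + 'e_k) (P k (adj (@opC _ _ _ _ U) y)))
    + adj (@opD _ _ _ _ U) y *+ (n == 0)) by rewrite (adjointE adjS).
move=> u {}y; rewrite rS innerDl innerDr addrC oppr_eq0; congr (_ + _); last first.
  by case: eqP; rewrite ?inner0l ?inner0r // opD_adjoint.
rewrite -(opB_adjoint u) opC_adjoint.
have := resolvent_intertwine (- n) (adj (@opC _ _ _ _ U) y) cproj_linear adjA_linear.
under [X in _ = X]eq_bigr => k _ do rewrite -opprD.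
rewrite /resAadj => <-; rewrite inner_suml inner_sumr.
by apply: eq_bigr => k _; rewrite resA_adjoint cproj_adjoint.
Qed.

(** This is the defining property of the lurking isometry: applied to adjoints it
    says that [U] maps the pair of the adjoints of [Gamma_sum] and [beta] to the
    pair of the adjoints of [Gamma_shift] and [alpha]. The first component is
    read off [U], the second off the inverse of [U]. *)
Lemma transfer n x u :
  Gamma_sum n x + beta S n u =
  Gamma_shift n (opA x + opB U u) + alpha S n (opC x + opD U u).
Proof.
have Aadj p y : (Gamma_shift n p).2 + adj (S (- n)) y =
    (Gamma_sum n (adj (@opA _ _ _ _ U) p + adj (@opC _ _ _ _ U) y)).2
    + (adj (@opB _ _ _ _ U) p + adj (@opD _ _ _ _ U) y) *+ (n == 0).
  rewrite Gamma_shiftE Gamma_sumE /= realized_adj.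
  have -> : resAadj n p = p *+ (n == 0) +
      \sum_k resAadj (n + 'e_k) (P k (adj (@opA _ _ _ _ U) p)).
    rewrite /resAadj resolvent_recr ?oppr_eq0; last exact: PAadj_linear.
    by congr (_ + _); apply: eq_bigr => k _; rewrite opprD.
  under [X in _ = adj _ X + _]eq_bigr => k _
    do rewrite (linD (cproj_linear k)) (linD (resAadj_linear _)).
  rewrite big_split /= !(linD adjB_linear) mulrnDl.
  case: (n == 0); rewrite ?mulr1n ?mulr0n ?(lin0 adjB_linear) ?addr0 ?add0r //.
  rewrite -addrA addrC -!addrA; congr (_ + _); congr (_ + _).
  by rewrite addrC.
apply: hsum_eq.
  rewrite /= Gamma_sumE Gamma_shiftE /= rS.
  have -> : resA n x = x *+ (n == 0) + \sum_k resA (n - 'e_k) (P k (opA x)).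
    by rewrite /resA resolvent_recr //; exact: PA_linear.
  under [X in _ = opC X + _]eq_bigr => k _
    do rewrite (linD (cproj_linear k)) (linD (resA_linear _)).
  rewrite big_split /= !(linD opC_linear) mulrnDl.
  case: (n == 0); rewrite ?mulr1n ?mulr0n ?(lin0 opC_linear) ?addr0 ?add0r //.
  by rewrite [opC x + _]addrC [opD U u + _]addrC addrACA.
have := Aadj (opA x + opB U u) (opC x + opD U u).
have := coll_opK (x, u); rewrite coll_opE coll_adjE /= => -[-> ->] <-.
by [].
Qed.

End colligation_operators.

(** * Reproducing kernel spaces and overlapping spaces *)
Section finite_sums.
Variables (R : realType).

(** Every family summed below has finite support, so that its unconditional sum
    can be handled algebraically and converted by [finsum_has_sum] at the end. *)
Definition finsum (J : choiceType) (H : lmodType R[i]) (F : J -> H) (v : H) :=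
  exists s : seq J, [/\ uniq s, forall j, j \notin s -> F j = 0
    & \sum_(j <- s) F j = v].

Lemma sum_supp (J : choiceType) (H : lmodType R[i]) (F : J -> H) (s t : seq J) :
  uniq s -> uniq t -> {subset s <= t} -> (forall j, j \notin s -> F j = 0) ->
  \sum_(j <- t) F j = \sum_(j <- s) F j.
Proof.
move=> us ut st F0; rewrite (bigID (mem s)) /= [X in _ + X]big1; last by move=> j /F0.
rewrite addr0 -big_filter; apply: perm_big; apply: uniq_perm => //.
  exact: filter_uniq.
by move=> j; rewrite mem_filter; case: (boolP (j \in s)) => // /st ->.
Qed.

Lemma finsum0 (J : choiceType) (H : lmodType R[i]) :
  finsum (fun=> 0 : H) (0 : H) (J := J).
Proof. by exists [::]; split=> //; rewrite big_nil. Qed.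

Lemma finsumD (J : choiceType) (H : lmodType R[i]) (F G : J -> H) v w :
  finsum F v -> finsum G w -> finsum (fun j => F j + G j) (v + w).
Proof.
move=> [s [us Fs <-]] [t [ut Gt <-]]; exists (undup (s ++ t)).
have sub (r : seq J) : {subset r <= s ++ t} -> {subset r <= undup (s ++ t)}.
  by move=> h j /h; rewrite mem_undup.
split; first exact: undup_uniq.
  move=> j; rewrite mem_undup mem_cat negb_or => /andP[/Fs -> /Gt ->].
  by rewrite addr0.
rewrite big_split /=; congr (_ + _).
  apply: sum_supp Fs => //; first exact: undup_uniq.
  by apply: sub => j js; rewrite mem_cat js.
apply: sum_supp Gt => //; first exact: undup_uniq.
by apply: sub => j js; rewrite mem_cat js orbT.
Qed.

Lemma finsum_sum (J : choiceType) (H : lmodType R[i]) I (r : seq I)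
  (F : I -> J -> H) (v : I -> H) : (forall i, finsum (F i) (v i)) ->
  finsum (fun j => \sum_(i <- r) F i j) (\sum_(i <- r) v i).
Proof.
move=> h; elim: r => [|i r IH].
  rewrite big_nil; have [s [us s0 sv]] := finsum0 J H.
  by exists s; split => // [j _|]; rewrite ?big_nil // big1 // => j _; rewrite big_nil.
have [s [us s0 sv]] := finsumD (h i) IH.
exists s; split => // [j js|]; rewrite big_cons; first exact: s0.
by rewrite -sv; apply: eq_bigr => j _; rewrite big_cons.
Qed.

Lemma finsum_ext (J : choiceType) (H : lmodType R[i]) (F G : J -> H) v :
  F =1 G -> finsum G v -> finsum F v.
Proof. by move=> /funext ->. Qed.

Lemma finsum_lin (J : choiceType) (H H' : lmodType R[i]) (f : H -> H')
    (F : J -> H) v : linear f -> finsum F v -> finsum (fun j => f (F j)) (f v).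
Proof.
move=> lf [s [us Fs <-]]; exists s; split=> // [j /Fs ->|]; first exact: lin0.
by rewrite (lin_sum lf).
Qed.

Lemma finsum_inj (J J' : choiceType) (H : lmodType R[i]) (e : J -> J')
    (F : J -> H) (F' : J' -> H) v : injective e ->
  (forall j, F' (e j) = F j) -> (forall j', (forall j, j' != e j) -> F' j' = 0) ->
  finsum F v -> finsum F' v.
Proof.
move=> ie Fe F0 [s [us Fs <-]]; exists (map e s); split.
- by rewrite map_inj_uniq.
- move=> j' /mapP nj; have [[j ej]|ne] := pselect (exists j, j' = e j).
    by rewrite ej Fe Fs //; apply/negP => js; apply: nj; exists j.
  by apply: F0 => j; apply/eqP => ej; apply: ne; exists j.
- by rewrite big_map; apply: eq_bigr => j _; rewrite Fe.
Qed.

Lemma finsum_restrict (J : choiceType) (H : lmodType R[i]) (D : set J) (F : J -> H) v :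
  (forall j, ~ D j -> F j = 0) -> finsum F v -> finsum (fun j : D => F (val j)) v.
Proof.
move=> F0 [s [us Fs <-]]; exists (pmap insub s); split.
- exact: pmap_sub_uniq.
- by move=> j; rewrite mem_pmap_sub => /Fs.
have -> : \sum_(j <- pmap insub s) F (val (j : D)) =
    \sum_(j <- map val (pmap (insub : J -> option D) s)) F j by rewrite big_map.
rewrite (pmap_filter (@insubK _ _ _)) big_filter [RHS](bigID (fun j => j \in D)) /=.
rewrite [X in _ = _ + X]big1 => [|j /negP jD]; last first.
  by apply: F0 => Dj; apply: jD; rewrite inE.
by rewrite addr0; apply: eq_bigl => j; rewrite isSome_insub.
Qed.

Lemma finsum_has_sum (J : choiceType) (H : hilbertType R) (F : J -> H) v :
  finsum F v -> has_sum F v.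
Proof.
move=> [s [us Fs <-]]; apply: (@cvg_near_cst _ _ _ _ _ (@summability.totally_filter J)).
exists [fset j in s]%fset => // A /= sA.
rewrite /summability.partial_sum -[LHS](big_seq_fsetE _ A xpredT F).
apply: sum_supp => // j js; apply: (fsubsetP sA); by rewrite !inE.
Qed.

End finite_sums.

Section rkhs.
Variables (R : realType) (d : nat) (X G : hilbertType R).
Variables (L : 'rV[int]_d -> X -> G) (La : 'rV[int]_d -> G -> X).
Hypothesis LLa : forall n, adjoint (L n) (La n).

Definition joint_ker : set X := [set x | forall n, L n x = 0].

Lemma joint_ker_perp n g : perp joint_ker (La n g).
Proof. by move=> a /(_ n) La0; rewrite (adjointC (LLa n)) La0 inner0r. Qed.

(** The orthogonal complement of the common kernel is where the coefficients of
    [L] separate points, and it contains the range of each adjoint [La n]. *)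
Lemma factor_rkhs :
  is_rkhs (factor_kernel L) (fun (f : orthsub joint_ker) n => L n (val f)).
Proof.
have lL n := adjoint_linear (LLa n).
split.
- by move=> n a x y; rewrite -lL; congr (L n _);
    exact: (linearP (val : orthsub joint_ker -> X)).
- move=> x y Lxy; apply/val_inj/eqP; rewrite -subr_eq0; apply/eqP/inner_eq0.
  rewrite {1}innerBl.
  have k : joint_ker (val x - val y).
    by move=> n; rewrite (linB (lL n)) (congr1 (fun f => f n) Lxy) subrr.
  by rewrite !(orthsubP _ k) subrr.
- move=> m u; exists (Orthsub (joint_ker_perp m u)) => [|f].
    by apply/funext => n; rewrite /factor_kernel /= (adjointE (LLa m)).
  by rewrite orthsub_innerE SubK LLa.
Qed.

End rkhs.

(** The hypothesis on all reproducing kernel spaces is used on the concrete ones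
    of [factor_rkhs]; for finitely many kernels square summability is automatic. *)
Lemma overlap_free (R : realType) (d : nat) (X : 'I_d -> hilbertType R) (G : hilbertType R)
    (L : forall k, 'rV[int]_d -> X k -> G) La :
  (forall k n, adjoint (L k n) (La k n)) ->
  trivial_overlapping setT (fun k => factor_kernel (L k)) ->
  forall f : forall k, X k, (forall k, perp (joint_ker (L k)) (f k)) ->
    (forall n, \sum_k L k n (f k) = 0) -> forall k, f k = 0.
Proof.
move=> LLa tr f fp f0 k.
pose H k := orthsub (joint_ker (L k)) : hilbertType R.
have h := tr H (fun k (x : H k) n => L k n (val x)) (fun k _ => factor_rkhs (LLa k))
  (fun k => Orthsub (fp k) : H k) (fun k h => False_ind _ (h I)).
apply: (congr1 val (h _ _ k)).
- rewrite esum_fset; [|exact: finite_finset|]; last first.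
    by move=> i _; rewrite lee_fin exprn_ge0 // rnorm_ge0.
  by rewrite fsbig_finite; [rewrite sumEFin ltry|exact: finite_finset].
- move=> n.
  suff fs : finsum (fun j : [set: 'I_d] =>
      L (val j) n (val (Orthsub (fp (val j))))) (0 : G).
    exact: (finsum_has_sum fs).
  have fr : finsum (fun j => L j n (val (Orthsub (fp j)))) (0 : G); last first.
    exact: (finsum_restrict (fun j (h : ~ setT j) => False_ind _ (h I)) fr).
  exists (index_enum 'I_d); split; first exact: index_enum_uniq.
    by move=> j; rewrite mem_index_enum.
  by rewrite -[RHS](f0 n).
Qed.

(** * Strict close connectedness and uniqueness *)
Section observable_part.
Variables (R : realType) (d : nat) (E Es : hilbertType R) (U : colligation d E Es).
Local Notation H := (state U).
Local Notation P := (@cproj R d E Es U).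
Local Notation A := (@opA R d E Es U).
Local Notation B := (@opB R d E Es U).
Local Notation C := (@opC R d E Es U).
Hypothesis grU : GR_unitary U.

(** The vectors that no series [Gamma_k] sees; strict close connectedness will
    follow from their absence. *)
Definition hidden : set H := [set x | forall k n, Gamma k n x = 0].

Lemma hidden_perp : hidden = perp [set y | exists k n g, y = GammaA U k n g].
Proof.
apply/seteqP; split=> x /= hx.
  by move=> _ [k [n [g ->]]]; rewrite -(Gamma_adjoint grU) hx inner0l.
move=> k n; apply: inner_inj => g; rewrite inner0l (Gamma_adjoint grU).
by apply: hx; exists k, n, g.
Qed.

Lemma hidden_proj k x : (forall n, Gamma k n x = 0) -> hidden (P k x).
Proof. by move=> h j n; rewrite (Gamma_proj grU); case: eqP. Qed.

(** Modulo the hidden part, the components [P k x] lie in the reproducing kernel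
    spaces of the kernels [Gamma_k(z) Gamma_k(w)^*], where a trivial overlapping
    space forbids a nontrivial cancellation. *)
Lemma overlap_hidden (a : 'I_d -> 'rV[int]_d) :
  trivial_overlapping setT
    (fun k => shift_kernel (a k) (factor_kernel (@Gamma _ _ _ _ U k))) ->
  forall x, (forall n, \sum_k Gamma k (n - a k) x = 0) -> hidden x.
Proof.
move=> tr x x0; have := perp_projection [set y | exists k n g, y = GammaA U k n g] x.
rewrite -hidden_perp => -[m hm pm].
set r := x - m in pm.
suff r0 : r = 0 by move/eqP: r0; rewrite subr_eq0 => /eqP ->.
have lG k n := Gamma_linear grU k n.
have := overlap_free (L := fun k n => @Gamma _ _ _ _ U k (n - a k))
  (fun k n => @Gamma_adjoint _ _ _ _ U grU k (n - a k)) tr (f := fun k => P k r).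
move=> h; rewrite -(cproj_sum grU r) big1 // => k _; apply: h => [{}k w hw|n].
  rewrite (cproj_adjoint grU) pm //; apply: hidden_proj => n.
  by have := hw (n + a k); rewrite addrK.
rewrite -[RHS](x0 n); apply: eq_bigr => j _.
by rewrite (Gamma_proj grU) eqxx (linB (lG _ _)) hm subr0.
Qed.

Variable S : 'rV[int]_d -> E -> Es.
Hypothesis bS : forall n, bounded_op (S n).
Hypothesis rS : realizes U S.
Hypothesis tr0 : trivial_overlapping setT (fun k => factor_kernel (@Gamma _ _ _ _ U k)).
Hypothesis tr1 : trivial_overlapping setT
  (fun k => shift_kernel 'e_k (factor_kernel (@Gamma _ _ _ _ U k))).
Hypothesis ccU : closely_connected U.

Let lB := opB_linear grU.
Let lC := opC_linear grU.
Let lalpha n := adjoint_linear (alpha_adjoint bS n).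
Let lbeta n := adjoint_linear (beta_adjoint bS n).

Lemma Gamma_sum_hidden x : (forall n, Gamma_sum n x = 0) -> hidden x.
Proof.
move=> h; apply: (@overlap_hidden (fun=> 0)) => [|n].
  suff -> : (fun k => shift_kernel (0 : 'rV[int]_d) (factor_kernel (@Gamma _ _ _ _ U k))) =
    fun k => factor_kernel (@Gamma _ _ _ _ U k) by [].
  by apply/funext => k; apply/funext => n; apply/funext => m; rewrite /shift_kernel !subr0.
by under eq_bigr => k _ do rewrite subr0; exact: h.
Qed.

Lemma Gamma_shift_hidden x : (forall n, Gamma_shift n x = 0) -> hidden x.
Proof. by move=> h; apply: (@overlap_hidden (fun k => 'e_k)). Qed.

Lemma hidden_Gamma_sum x n : hidden x -> Gamma_sum n x = 0.
Proof. by move=> h; rewrite /Gamma_sum big1. Qed.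

Lemma hidden_Gamma_shift x n : hidden x -> Gamma_shift n x = 0.
Proof. by move=> h; rewrite /Gamma_shift big1. Qed.

Lemma hidden_C x : hidden x -> C x = 0.
Proof.
by move=> /(hidden_Gamma_sum 0); rewrite (Gamma_sumE grU) => -[+ _]; rewrite /resA resolvent0.
Qed.

Lemma hidden_Badj x : hidden x -> adj B x = 0.
Proof.
move=> /(hidden_Gamma_shift 0); rewrite (Gamma_shiftE grU) => -[_].
by rewrite /resAadj oppr0 resolvent0.
Qed.

(** The transfer identity at a hidden [x] loses all its terms but
    [Gamma_shift n (A x)], which forces [A x] to be hidden; the next lemma reads it
    backwards through the inverse of [U]. *)
Lemma hidden_A x : hidden x -> hidden (A x).
Proof.
move=> hx; apply: Gamma_shift_hidden => n; have := transfer grU rS n x 0.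
rewrite (hidden_Gamma_sum _ hx) (lin0 (lbeta _)) (lin0 lB) (lin0 (opD_linear grU)).
by rewrite (hidden_C hx) !addr0 (lin0 (lalpha _)) addr0 => <-.
Qed.

Lemma hidden_Aadj x : hidden x -> hidden (adj A x).
Proof.
move=> hx; apply: Gamma_sum_hidden => n.
have := transfer grU rS n (adj A x) (adj B x).
have := coll_opKV grU (x, 0); rewrite (coll_adjE grU) (coll_opE grU) /=.
rewrite (lin0 (adjC_linear grU)) (lin0 (adjD_linear grU)) !addr0.
move=> [-> ->]; rewrite (hidden_Gamma_shift _ hx) (lin0 (lalpha _)) (hidden_Badj hx).
by rewrite (lin0 (lbeta _)) !addr0.
Qed.

(** The orthogonal complement of the hidden part reduces the colligation and
    contains the ranges of [B] and [C^*], so close connectedness makes it the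
    whole space. *)
Theorem hidden_trivial x : hidden x -> x = 0.
Proof.
move=> hx; apply: inner_eq0; suff h : perp hidden = setT.
  have : perp hidden x by rewrite h.
  exact.
apply: ccU; first exact: perp_closed.
- exact: perp_subspace.
- by move=> u a /hidden_Badj a0; rewrite (opB_adjoint grU) a0 inner0r.
- by move=> y a /hidden_C a0; rewrite (adjointC (opC_adjoint grU)) a0 inner0r.
- by move=> y py a /hidden_Aadj ha; rewrite (opA_adjoint grU) py.
- by move=> y py a /hidden_A ha; rewrite (adjointC (opA_adjoint grU)) py.
- by move=> k y py a ha; rewrite (cproj_adjoint grU) py //; exact: hidden_proj.
Qed.

Lemma good_scc : strictly_closely_connected U.
Proof.
move=> x y xy; apply/eqP; rewrite -subr_eq0; apply/eqP/hidden_trivial/Gamma_sum_hidden => n.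
rewrite /Gamma_sum; under eq_bigr => k _ do rewrite (linB (Gamma_linear grU k n)).
rewrite sumrB -[X in X - _]/(Gamma_sum n x) -[X in _ - X]/(Gamma_sum n y) !(Gamma_sumE grU).
by rewrite (congr1 (fun f => f n) xy) subrr.
Qed.

(** The series [Gamma_shift(z) y] has no [E_*]-coefficient at [0], while that of
    [alpha(z) q] is [q]; hence [q] is determined first. *)
Lemma Gamma_shift_alpha_inj (y : H) (q : Es) (y' : H) q' :
  (forall n, Gamma_shift n y + alpha S n q = Gamma_shift n y' + alpha S n q') -> y = y' /\ q = q'.
Proof.
have lG n : linear (@Gamma_shift _ _ _ _ U n).
  move=> a u v; rewrite /Gamma_shift scaler_sumr -big_split; apply: eq_bigr => k _.
  by rewrite (Gamma_linear grU).
move=> h; have {}h n : Gamma_shift n (y - y') + alpha S n (q - q') = 0.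
  rewrite (linB (lG n)) (linB (lalpha n)).
  by rewrite addrACA -opprD h subrr.
have q0 : q - q' = 0.
  have := congr1 fst (h 0); rewrite (Gamma_shiftE grU) /= eqxx big1 ?(lin0 lC) ?add0r //.
  move=> k _; rewrite /resA resolvent_supp //; first exact: PA_linear.
  by rewrite degree_nonneg // degreeBe degree0.
have y0 : y - y' = 0.
  apply: hidden_trivial; apply: Gamma_shift_hidden => n.
  by have := h n; rewrite q0 (lin0 (lalpha n)) addr0.
by move/eqP: y0; move/eqP: q0; rewrite !subr_eq0 => /eqP -> /eqP ->.
Qed.

End observable_part.

Section uniqueness.
Variables (R : realType) (d : nat) (E Es : hilbertType R).
Variables (U U' : colligation d E Es) (S : 'rV[int]_d -> E -> Es).
Hypotheses (grU : GR_unitary U) (grU' : GR_unitary U').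
Hypotheses (rS : realizes U S) (rS' : realizes U' S).
Hypothesis KK : forall k, factor_kernel (@Gamma _ _ _ _ U k) =
                          factor_kernel (@Gamma _ _ _ _ U' k).
Hypothesis h0 : forall x : state U, hidden x -> x = 0.
Hypothesis h0' : forall x : state U', hidden x -> x = 0.
Hypothesis gi' : forall (y : state U') (q : Es) (y' : state U') q',
  (forall n, Gamma_shift (U := U') n y + alpha S n q = Gamma_shift n y' + alpha S n q') ->
  y = y' /\ q = q'.

(** Compatibility gives the adjoints of the two families [Gamma_k] the same Gram
    matrix, hence a unitary [W]; it intertwines the colligations because both
    are determined by the transfer identity. *)
Lemma compatible_unitarily_equivalent : unitarily_equivalent U U'.
Proof.
pose I := ('I_d * 'rV[int]_d * hsum Es E)%type.
pose a (V : colligation d E Es) (i : I) := GammaA V i.1.1 i.1.2 i.2.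
have tot (V : colligation d E Es) : GR_unitary V ->
    (forall x : state V, hidden x -> x = 0) -> total_family (a V).
  move=> grV hV x xa; apply: hV => k n; apply: inner_inj => g.
  by rewrite inner0l (Gamma_adjoint grV); exact: (xa (k, n, g)).
have gramE (V : colligation d E Es) : GR_unitary V -> forall i j : I,
    inner (a V i) (a V j) =
    if j.1.1 == i.1.1
    then inner (factor_kernel (@Gamma _ _ _ _ V i.1.1) j.1.2 i.1.2 i.2) j.2 else 0.
  move=> grV i j; rewrite -(Gamma_adjoint grV) /a.
  have -> : GammaA V i.1.1 i.1.2 i.2 = cproj i.1.1 (GammaA V i.1.1 i.1.2 i.2).
    by rewrite /GammaA (cproj_id grV).
  rewrite (Gamma_proj grV); case: eqP => [_|_]; last by rewrite inner0l.
  by rewrite /factor_kernel /= (adjointE (Gamma_adjoint grV _ _)).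
have [|W [lW iW sW] Wa] := gram_unitary (tot U grU h0) (tot U' grU' h0').
  by move=> i j; rewrite !gramE // KK.
have GW k n x : Gamma k n (W x) = Gamma k n x.
  apply: inner_inj => g; rewrite (Gamma_adjoint grU) (Gamma_adjoint grU').
  by rewrite -[GammaA U' k n g](Wa (k, n, g)) iW.
have Hinj (y y' : state U') : (forall k n, Gamma k n y = Gamma k n y') -> y = y'.
  move=> e; apply/eqP; rewrite -subr_eq0; apply/eqP/h0' => k n.
  by rewrite (linB (Gamma_linear grU' k n)) e subrr.
exists W; split => // [k x|x u].
  by apply: Hinj => j n; rewrite GW (Gamma_proj grU) (Gamma_proj grU') GW.
have [] := gi' (y := (U' (W x, u)).1) (q := (U' (W x, u)).2)
  (y' := W (U (x, u)).1) (q' := (U (x, u)).2).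
  move=> n; rewrite !coll_opE //= -(transfer grU' rS').
  have -> : Gamma_shift n (W (opA x + opB U u)) = Gamma_shift n (opA x + opB U u).
    by apply: eq_bigr => k _; rewrite GW.
  rewrite -(transfer grU rS); congr (_ + _).
  by apply: eq_bigr => k _; rewrite GW.
by move=> e1 e2; apply: hsum_eq.
Qed.

End uniqueness.

(** * Existence *)
Lemma contraction_continuous (R : realType) (H1 H2 : hilbertType R) (f : H1 -> H2) :
  linear f -> (forall x, `|f x| <= `|x|) -> continuous f.
Proof.
move=> lf fle x B /nbhs_ballP[e /= e0 eB]; apply/nbhs_ballP; exists e => //= y.
rewrite -ball_normE /= => xy; apply: eB; rewrite -ball_normE /=.
by rewrite -(linB lf) (le_lt_trans (fle _)).
Qed.

Section existence.
Variables (R : realType) (d : nat) (E Es : hilbertType R).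
Variable S : 'rV[int]_d -> E -> Es.
Hypothesis bS : forall n, bounded_op (S n).
Variables (Y : 'I_d -> hilbertType R).
Variables (F : forall k, 'rV[int]_d -> Y k -> hsum Es E).
Arguments F : clear implicits.
Variables (Fa : forall k, 'rV[int]_d -> hsum Es E -> Y k).
Hypothesis FFa : forall k n, adjoint (F k n) (Fa k n).
Hypothesis F1 : forall k n x, ~~ nonneg n -> (F k n x).1 = 0.
Hypothesis F2 : forall k n x, ~~ nonneg (- n - 'e_k) -> (F k n x).2 = 0.
Hypothesis inj0 : forall x : dsum Y, (forall n, \sum_k F k n (x k) = 0) -> x = 0.
Hypothesis inj1 : forall x : dsum Y,
  (forall n, \sum_k F k (n - 'e_k) (x k) = 0) -> x = 0.
Hypothesis agl : forall n m v, agler_lhs S n m v =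
  \sum_k (F k n (Fa k m v) - F k (n - 'e_k) (Fa k (m - 'e_k) v)).

Let lF k n : linear (F k n) := adjoint_linear (@FFa k n).
Let lalpha n := adjoint_linear (alpha_adjoint bS n).
Let lbeta n := adjoint_linear (beta_adjoint bS n).

Let Phi n (x : dsum Y) : hsum Es E := \sum_k F k n (x k).
Let Phia n (g : hsum Es E) : dsum Y := fun k => Fa k n g.
Let Psi n (x : dsum Y) : hsum Es E := \sum_k F k (n - 'e_k) (x k).
Let Psia n (g : hsum Es E) : dsum Y := fun k => Fa k (n - 'e_k) g.

Let Phi_adjoint n : adjoint (Phi n) (Phia n).
Proof. by move=> x g; rewrite inner_suml; apply: eq_bigr => k _; rewrite FFa. Qed.

Let Psi_adjoint n : adjoint (Psi n) (Psia n).
Proof. by move=> x g; rewrite inner_suml; apply: eq_bigr => k _; rewrite FFa. Qed.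

Let a (i : 'rV[int]_d * hsum Es E) : hsum (dsum Y) E := (Phia i.1 i.2, betaA S i.1 i.2).
Let b (i : 'rV[int]_d * hsum Es E) : hsum (dsum Y) Es := (Psia i.1 i.2, alphaA S i.1 i.2).

Let innera p i : inner p (a i) = inner (Phi i.1 p.1 + beta S i.1 p.2) i.2.
Proof. by rewrite innerDl Phi_adjoint (beta_adjoint bS). Qed.

Let innerb p i : inner p (b i) = inner (Psi i.1 p.1 + alpha S i.1 p.2) i.2.
Proof. by rewrite innerDl Psi_adjoint (alpha_adjoint bS). Qed.

Let not_nonneg_e k : ~~ nonneg (0 - 'e_k : 'rV[int]_d).
Proof. by rewrite degree_nonneg // degreeBe degree0. Qed.

(** The second component at [0] isolates [p.2], because the support of the
    [E]-component of [F k] avoids [0]. *)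
Let total_a : total_family a.
Proof.
move=> p pa; have h n : Phi n p.1 + beta S n p.2 = 0.
  by apply: inner_inj => g; rewrite inner0l -(innera p (n, g)).
have p2 : p.2 = 0.
  have := congr1 snd (h 0); rewrite /Phi hsum_sum /= eqxx big1 ?add0r // => k _.
  by rewrite F2 // oppr0.
apply: hsum_eq => //; apply: inj0 => n.
by have := h n; rewrite p2 (lin0 (lbeta n)) addr0.
Qed.

Let total_b : total_family b.
Proof.
move=> p pb; have h n : Psi n p.1 + alpha S n p.2 = 0.
  by apply: inner_inj => g; rewrite inner0l -(innerb p (n, g)).
have p2 : p.2 = 0.
  have := congr1 fst (h 0); rewrite /Psi hsum_sum /= eqxx big1 ?add0r // => k _.
  by rewrite F1.
apply: hsum_eq => //; apply: inj1 => n.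
by have := h n; rewrite p2 (lin0 (lalpha n)) addr0.
Qed.

(** Moving the negative terms of the augmented Agler decomposition to the other
    side leaves one Gram matrix on each side. *)
Let gram_ab i j : inner (a i) (a j) = inner (b i) (b j).
Proof.
rewrite innera innerb; congr (inner _ _); apply/eqP.
rewrite /= -subr_eq0 opprD addrACA addr_eq0 opprB -(agler_lhsE bS) agl.
by rewrite /Phi /Psi sumrB.
Qed.

Let proj_linear k : linear (dsum_proj (Y := Y) k).
Proof.
move=> c x y; apply/functional_extensionality_dep => i; rewrite /dsum_proj.
have E1 (u v : dsum Y) : (c *: u + v) i = c *: u i + v i by [].
by rewrite !E1; case: eqP => // _; rewrite scaler0 addr0.
Qed.

Let proj_adjoint k : adjoint (dsum_proj (Y := Y) k) (dsum_proj (Y := Y) k).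
Proof.
move=> x y; rewrite !dsum_innerE; apply: eq_bigr => i _.
by rewrite /dsum_proj; case: eqP => // _; rewrite inner0l inner0r.
Qed.

Let proj_id k (x : dsum Y) : dsum_proj k (dsum_proj k x) = dsum_proj k x.
Proof.
by apply/functional_extensionality_dep => i; rewrite /dsum_proj; case: eqP.
Qed.

Let proj_orth j k : j != k -> forall x : dsum Y, dsum_proj j (dsum_proj k x) = 0.
Proof.
move=> jk x; apply/functional_extensionality_dep => i; rewrite /dsum_proj.
by case: eqP => // ->; rewrite (negPf jk).
Qed.

Let proj_sum (x : dsum Y) : \sum_k dsum_proj k x = x.
Proof.
apply/functional_extensionality_dep => i; rewrite dsum_sum (bigD1 i) //= big1.
  by rewrite addr0 /dsum_proj eqxx.
by move=> k ki; rewrite /dsum_proj eq_sym (negPf ki).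
Qed.

Let proj_bounded k : bounded_op (dsum_proj (Y := Y) k).
Proof.
split; [exact: proj_linear | apply: contraction_continuous; first exact: proj_linear].
move=> x; rewrite -(@ler_pXn2r _ 2) ?nnegrE // -!innerxx !dsum_innerE.
apply: ler_sum => i _; rewrite /dsum_proj; case: eqP => // _.
by rewrite inner0l inner_ge0.
Qed.

(** The unitary map of the two total families is the colligation operator. Taking
    adjoints, it satisfies the transfer identity [transferU]; the supports of the
    first and second components turn it into recursions that are solved by the
    resolvents, which identifies [Gamma k n] with [F k n]. *)
Section with_colligation.
Variable W : hsum (dsum Y) E -> hsum (dsum Y) Es.
Hypothesis uW : unitary_op W.
Hypothesis Wa : forall i, W (a i) = b i.

Let U : colligation d E Es := Colligation (state := dsum Y) (@dsum_proj R 'I_d Y) W.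
Local Notation A := (@opA R d E Es U).
Local Notation B := (@opB R d E Es U).
Local Notation C := (@opC R d E Es U).

Let grU : GR_unitary U.
Proof.
split; [move=> k; split | exact: proj_orth | exact: proj_sum | exact: uW].
- exact: proj_bounded.
- exact: proj_id.
- exact: proj_adjoint.
Qed.

Let transferU n x u :
  Phi n x + beta S n u = Psi n (A x + B u) + alpha S n (C x + opD U u).
Proof.
have := coll_opE grU (x, u) => /= Wxu; apply: inner_inj => g.
rewrite -(innera (x, u) (n, g)); have [_ iW _] := uW.
by rewrite -iW Wa innerb /= Wxu.
Qed.

Let Phi_proj n k x : Phi n (dsum_proj k x) = F k n (x k).
Proof.
rewrite /Phi (bigD1 k) //= big1 => [|j jk]; last first.
  by rewrite /dsum_proj (negPf jk) (lin0 (lF _)).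
by rewrite addr0 /dsum_proj eqxx.
Qed.

Let Psi_proj n k x : Psi n (dsum_proj k x) = F k (n - 'e_k) (x k).
Proof.
rewrite /Psi (bigD1 k) //= big1 => [|j jk]; last first.
  by rewrite /dsum_proj (negPf jk) (lin0 (lF _)).
by rewrite addr0 /dsum_proj eqxx.
Qed.

Let Phi1E n x : (Phi n x).1 = C (resA (U := U) n x).
Proof.
apply: (@resolvent_unique _ _ _ _ U (fun k => cproj k \o A) Es (fun n x => (Phi n x).1)).
- exact: PA_linear.
- exact: opC_linear.
- by move=> {}n {}x nn; rewrite /Phi hsum_sum /= big1 // => k _; rewrite F1.
move=> {}n {}x; have := congr1 fst (transferU n x 0).
rewrite (lin0 (lbeta n)) (lin0 (opB_linear grU)) (lin0 (opD_linear grU)) !addr0 /= => ->.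
congr (_ + _); rewrite /Psi hsum_sum /=; apply: eq_bigr => k _.
by rewrite Phi_proj.
Qed.

Let Psi2E n x : (Psi n x).2 = adj B (resAadj (U := U) n x).
Proof.
rewrite -{1}[n]opprK.
apply: (@resolvent_unique _ _ _ _ U (fun k => cproj k \o adj A) E
  (fun n x => (Psi (- n) x).2)).
- exact: PAadj_linear.
- exact: adjB_linear.
- move=> {}n {}x nn; rewrite /Psi hsum_sum /= big1 // => k _; rewrite F2 //.
  by rewrite opprB opprK addrC addKr.
move=> {}n {}x; have := congr1 snd (transferU (- n) (adj A x) (adj B x)).
have := coll_opKV grU (x, 0); rewrite (coll_adjE grU) (coll_opE grU) /=.
rewrite (lin0 (adjC_linear grU)) (lin0 (adjD_linear grU)) !addr0.
move=> [-> ->]; rewrite oppr_eq0 (lin0 (adjoint_linear (adjointC (adjP (bS _))))) addr0 => <-.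
congr (_ + _); rewrite /Phi hsum_sum /=; apply: eq_bigr => k _.
by rewrite Psi_proj opprB addrAC subrr add0r.
Qed.

Let GammaE k n x : Gamma (U := U) k n x = F k n (x k).
Proof.
apply: hsum_eq; rewrite /= -?Phi1E -?Psi2E /=; first by rewrite Phi_proj.
by rewrite Psi_proj addrK.
Qed.

Lemma colligation_of_gram :
  [/\ GR_unitary U, closely_connected U, realizes U S &
   compatible U (fun k n m v => F k n (Fa k m v))].
Proof.
split => //.
- move=> M cM sM MB MC MA MAa MP; apply/seteqP; split => // x _.
  have [m Mm xm] := projection cM sM x.
  suff r0 : x - m = 0 by move/eqP: r0; rewrite subr_eq0 => /eqP ->.
  apply: inj0 => n; rewrite big1 // => k _; rewrite -GammaE.
  apply: inner_inj => g; rewrite inner0l (Gamma_adjoint grU) xm //.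
  apply: (MP); rewrite -[X in M (X + _)]scale1r; apply: (sM.2).
    apply: resolvent_stable => // j y My; exact/MAa/MP.
  by apply: resolvent_stable => // j y My; exact/MA/MP.
- move=> n u; have := congr1 fst (transferU n 0 u).
  rewrite /Phi big1 => [|k _]; last exact: (lin0 (lF _)).
  rewrite (lin0 (opA_linear grU)) (lin0 (opC_linear grU)) !add0r /= => ->.
  rewrite addrC; congr (_ + _); rewrite (lin_sum (opC_linear grU)).
  rewrite /Psi hsum_sum /=; apply: eq_bigr => k _.
  by rewrite -Phi1E Phi_proj.
- move=> k; apply/funext => n; apply/funext => m; apply/funext => v.
  rewrite /factor_kernel /= GammaE.
  suff /adjointE -> : adjoint (Gamma (U := U) k m) (fun g => dsum_proj k (Phia m g)).
    by rewrite /dsum_proj eqxx.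
  by move=> x g; rewrite GammaE -proj_adjoint -Phi_adjoint Phi_proj.
Qed.

End with_colligation.

Theorem exists_colligation : exists U : colligation d E Es,
  [/\ GR_unitary U, closely_connected U, realizes U S &
   compatible U (fun k n m v => F k n (Fa k m v))].
Proof.
have [W uW Wa] := gram_unitary total_a total_b gram_ab.
by have := colligation_of_gram uW Wa; exists (Colligation (@dsum_proj R 'I_d Y) W).
Qed.

End existence.

(** * Scattering minimality *)
Lemma degreeMz (d : nat) (n : 'rV[int]_d) (t : int) : degree (n *~ t) = degree n * t.
Proof.
have nat_case (N : nat) : degree (n *+ N) = degree n * N%:Z.
  elim: N => [|N IH]; first by rewrite mulr0n degree0 mulr0.
  by rewrite mulrS degreeD IH intS mulrDr mulr1.
case: t => N; first by rewrite -pmulrn nat_case.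
by rewrite NegzE mulrNz -pmulrn degreeN nat_case mulrN.
Qed.

Section flow.
Variables (R : realType) (d : nat) (E Es : hilbertType R) (U : colligation d E Es).
Local Notation H := (state U).
Implicit Types (Q : 'I_d -> H -> H) (y v : 'rV[int]_d -> H) (c : int).

(** [flow c Q y] is the solution of [v m = \sum_k Q k (v (m - e_k))] in degrees
    above [c] that starts from [y] on the hyperplane of degree [c]. *)
Fixpoint flow_steps Q y (N : nat) (m : 'rV[int]_d) : H :=
  if N is N'.+1 then \sum_k Q k (flow_steps Q y N' (m - 'e_k)) else y m.

Definition flow c Q y m : H :=
  if c <= degree m then flow_steps Q y `|degree m - c|%N m else 0.

Lemma flow_sum c Q I (r : seq I) (y : I -> 'rV[int]_d -> H) m :
  (forall k, linear (Q k)) ->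
  \sum_(i <- r) flow c Q (y i) m = flow c Q (fun n => \sum_(i <- r) y i n) m.
Proof.
move=> lQ; rewrite /flow; case: ifP => _; last by rewrite big1.
move: (absz (degree m - c)) => N; elim: N m => [|N IH] m //=.
rewrite exchange_big; apply: eq_bigr => k _ /=.
by rewrite -(lin_sum (lQ k)) IH.
Qed.

Lemma flow_solution c Q v m :
  (forall n, c < degree n -> v n = \sum_k Q k (v (n - 'e_k))) ->
  flow c Q v m = if c <= degree m then v m else 0.
Proof.
move=> hv; rewrite /flow; case: ifP => // cm.
have : degree m = c + `|degree m - c|%N%:Z.
  by rewrite gez0_abs ?subr_ge0 // addrCA subrr addr0.
move: (absz (degree m - c)) {cm} => N; elim: N m => [|N IH] m //= dm.
rewrite hv; last by rewrite dm ltrDl.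
by apply: eq_bigr => k _; rewrite IH // degreeBe dm intS [1 + _]addrC addrA addrK.
Qed.

(** Only finitely many initial values influence the value at [m], and they do so
    through the coefficients of the resolvent. *)
Lemma finsum_resolvent c Q y m : (forall k, linear (Q k)) ->
  finsum (fun n => resolvent Q (m - n) (y n) *+ (degree n == c)) (flow c Q y m).
Proof.
move=> lQ; rewrite /flow; case: leP => [cm|mc]; last first.
  exists [::]; split; rewrite ?big_nil // => n _; case: eqP => // nc.
  by rewrite resolvent_supp ?mul0rn // degree_nonneg // degreeD degreeN nc subr_lt0.
have : degree m = c + `|degree m - c|%N%:Z.
  by rewrite gez0_abs ?subr_ge0 // addrCA subrr addr0.
move: (absz (degree m - c)) {cm} => N; elim: N m => [|N IH] m dm /=.
  exists [:: m]; split=> // [n|]; last by rewrite big_seq1 subrr resolvent0 dm addr0 eqxx.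
  rewrite inE => nm; case: eqP => // nc.
  have /(resolventE Q) -> : degree (m - n) = 0%N.
    by rewrite degreeD degreeN nc dm addr0 subrr.
  by rewrite /= subr_eq0 eq_sym (negPf nm) mul0rn.
have step n : resolvent Q (m - n) (y n) *+ (degree n == c) =
    \sum_k Q k (resolvent Q (m - 'e_k - n) (y n) *+ (degree n == c)).
  case: eqP => [nc|_]; last by rewrite big1 // => k _; rewrite (lin0 (lQ k)).
  rewrite resolvent_rec // subr_eq0; case: eqP => [mn|_].
    by move: dm; rewrite mn nc -[LHS]addr0 => /addrI.
  by rewrite add0r mulr1n; apply: eq_bigr => k _; rewrite mulr1n addrAC.
apply: (finsum_ext step); apply: (finsum_sum (index_enum 'I_d)) => k.
apply: (finsum_lin (lQ k)); apply: IH.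
by rewrite degreeBe dm intS [1 + _]addrC addrA addrK.
Qed.

End flow.

Section minimality.
Variables (R : realType) (d : nat) (E Es : hilbertType R) (U : colligation d E Es).
Local Notation H := (state U).
Local Notation P := (@cproj R d E Es U).
Local Notation A := (@opA R d E Es U).
Local Notation B := (@opB R d E Es U).
Local Notation C := (@opC R d E Es U).
Hypothesis grU : GR_unitary U.
Variable x : 'rV[int]_d -> H.
Hypothesis tx : trajectory (fun=> 0) x (fun=> 0).

Let xC n : C (x n) = 0.
Proof. by have [_ /(_ n)] := tx; rewrite (lin0 (opD_linear grU)) addr0. Qed.

Let xA n k : P k (x (n + 'e_k)) = P k (A (x n)).
Proof. by have [-> _] := tx; rewrite (lin0 (opB_linear grU)) addr0. Qed.

Let x_forward n : x n = \sum_k P k (A (x (n - 'e_k))).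
Proof.
by rewrite -[LHS](cproj_sum grU); apply: eq_bigr => k _; rewrite -xA subrK.
Qed.

Let Ax n : A (x n) = \sum_k P k (x (n + 'e_k)).
Proof.
by rewrite -[LHS](cproj_sum grU); apply: eq_bigr => k _; rewrite xA.
Qed.

Let x_back n : x n = adj A (A (x n)) /\ adj B (A (x n)) = 0.
Proof.
have := coll_opK grU (x n, 0); rewrite (coll_opE grU) (coll_adjE grU) /=.
rewrite (lin0 (opB_linear grU)) (lin0 (opD_linear grU)) !addr0 xC.
rewrite (lin0 (adjC_linear grU)) (lin0 (adjD_linear grU)) !addr0.
by move=> [-> ->].
Qed.

(** The state evolves forward by [A]; as the output vanishes too, it also evolves
    backward, by the adjoint of [A]. *)
Lemma trajectory_eq0 : (forall n, degree n = 0 -> x n = 0) -> x = fun=> 0.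
Proof.
move=> x0; apply/funext => n.
have : exists N : nat, degree n = N%:Z \/ degree n = - N%:Z.
  by exists `|degree n|%N; case: (degree n) => N; [left | right].
move=> [N [|]]; elim: N n => [|N IH] n dn; first exact: x0.
- rewrite x_forward big1 // => k _.
  rewrite IH ?(lin0 (opA_linear grU)) ?(lin0 (cproj_linear grU k)) //.
  by rewrite degreeBe dn intS addrC addKr.
- by apply: x0; rewrite dn oppr0.
- have [-> _] := x_back n; rewrite Ax big1 ?(lin0 (adjA_linear grU)) // => k _.
  rewrite IH ?(lin0 (cproj_linear grU k)) //.
  by rewrite degreeDe dn intS opprD addrC addrA subrr add0r.
Qed.

(** The contribution of the component [P k x] to the coefficient at [m] of the
    overlapping series: the initial values on the hyperplane of degree [0] flow
    forward under [A], and those of [A x] flow backward, written after the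
    reflection [p = e_k - n] as a flow starting from degree [1]. *)
Let v (k : 'I_d) m : hsum Es E :=
  (C (flow 0 (fun k => P k \o A) (fun n => P k (x n)) m),
   adj B (flow 1 (fun k => P k \o adj A) (fun p => P k (x ('e_k - p))) (- m))).

Let Gamma_finsum k m :
  finsum (fun n => Gamma k (m - n) (P k (x n)) *+ (degree n == 0)) (v k m).
Proof.
have l1 : linear (fun y : Es => (y, 0) : hsum Es E).
  by move=> a y z; apply: hsum_eq; rewrite //= scaler0 addr0.
have l2 : linear (fun y : E => (0, y) : hsum Es E).
  by move=> a y z; apply: hsum_eq; rewrite //= scaler0 addr0.
have f1 := finsum_lin l1 (finsum_lin (opC_linear grU)
  (finsum_resolvent 0 (fun n => P k (x n)) m (PA_linear grU))).
have f2 := finsum_lin l2 (finsum_lin (adjB_linear grU)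
  (finsum_resolvent 1 (fun p => P k (x ('e_k - p))) (- m) (PAadj_linear grU))).
have f2' : finsum (fun n =>
    (0, adj B (resAadj (m - n + 'e_k) (P k (x n)) *+ (degree n == 0))) : hsum Es E)
    (0, adj B (flow 1 (fun k => P k \o adj A) (fun p => P k (x ('e_k - p))) (- m))).
  apply: (finsum_inj (e := fun p => 'e_k - p)) f2 => [p q /addrI/oppr_inj //|p|n nn].
    rewrite degreeD degreeN degree_e subr_eq0 eq_sym /resAadj.
    by have -> : - (m - ('e_k - p) + 'e_k) = - m - p by rewrite opprB addrA subrK opprD.
  by have := nn ('e_k - n); rewrite opprB addrC subrK eqxx.
have := finsumD f1 f2'.
have -> : (C (flow 0 (fun k => P k \o A) (fun n => P k (x n)) m), 0) + (0, adj B
   (flow 1 (fun k => P k \o adj A) (fun p => P k (x ('e_k - p))) (- m))) = v k m.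
  by apply: hsum_eq; rewrite /= ?addr0 ?add0r.
apply: finsum_ext => n; rewrite /Gamma /resA (cproj_id grU).
case: eqP => _.
  by rewrite !mulr1n; apply: hsum_eq; rewrite /= ?addr0 ?add0r.
by rewrite !mulr0n (lin0 (opC_linear grU)) (lin0 (adjB_linear grU)) addr0.
Qed.

(** Adding up the components gives [C] applied to [x m], or the adjoint of [B]
    applied to [A (x m)], and both vanish along the trajectory. *)
Let v_sum m : \sum_k v k m = 0.
Proof.
rewrite /v hsum_sum; apply: hsum_eq => /=.
  rewrite -(lin_sum (opC_linear grU)) flow_sum; last exact: PA_linear.
  have -> : (fun n => \sum_k P k (x n)) = x by apply/funext => n; exact: cproj_sum.
  rewrite flow_solution => [|n _]; last exact: x_forward.
  by case: ifP; rewrite ?xC ?(lin0 (opC_linear grU)).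
rewrite -(lin_sum (adjB_linear grU)) flow_sum; last exact: PAadj_linear.
have -> : (fun p => \sum_k P k (x ('e_k - p))) = fun p => A (x (- p)).
  by apply/funext => p; rewrite Ax; apply: eq_bigr => k _; rewrite addrC.
rewrite flow_solution => [|n _].
  case: ifP; rewrite ?(lin0 (adjB_linear grU)) // => _.
  by have [] := x_back (- - m).
rewrite Ax; apply: eq_bigr => k _; congr (P k _).
have -> : - (n - 'e_k) = - n + 'e_k by rewrite opprB addrC.
by have [] := x_back (- n + 'e_k).
Qed.

Let proj_norm k y : inner (P k y) (P k y) <= inner y y.
Proof.
have := inner_ge0 (y - P k y); rewrite innerBl !innerBr.
by rewrite !(cproj_adjoint grU) !(cproj_id grU) subrr subr0 subr_ge0.
Qed.

Hypothesis ax : admissible (fun=> 0) x (fun=> 0).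

Let sum_x : (\esum_(n in [set n : 'rV[int]_d | degree n = 0%R])
  (rnorm (x n) ^+ 2)%:E < +oo)%E.
Proof.
have sq0 (V : hilbertType R) (z : V) : (0 <= (rnorm z ^+ 2)%:E)%E.
  by rewrite lee_fin exprn_ge0 // rnorm_ge0.
apply: le_lt_trans ax; rewrite -addeA.
apply: (le_trans _ (leeDr _ _)); last by apply: esum_ge0.
by apply: leeDl; apply: esum_ge0.
Qed.

(** For this half space the boundary is the hyperplane of degree [0] in each
    direction, and no line parallel to an axis is contained in it or misses it. *)
Let Om : set 'rV[int]_d := [set n | 0 <= degree n].

Let Om_bdry j : bdry_set Om j <-> exists k n, j = inl (k, n) /\ degree n = 0.
Proof.
split=> [|[k [n [-> n0]]]]; last first.
  by split=> [|t]; rewrite /Om /= ?degreeD ?degreeMz ?degree_e n0 // add0r mul1r.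
case: j => [[k n]|[[k n]|[k n]]] /=.
- move=> [n0 h]; exists k, n; split => //; apply/eqP; rewrite eq_le n0 andbT.
  have := h (- degree n); rewrite /Om /= degreeD degreeMz degree_e mul1r subrr.
  by rewrite oppr_ge0; apply.
- move=> [_ /seteqP[h _]]; have [] := h (n + 'e_k *~ `|degree n|); split.
    by exists `|degree n|.
  by rewrite /Om /= degreeD degreeMz degree_e mul1r -lerBlDl sub0r ler_normr lexx orbT.
- move=> [_ h]; have := h (n + 'e_k *~ (- degree n - 1)) (ex_intro2 _ _ _ I erefl).
  by rewrite /Om /= degreeD degreeMz degree_e mul1r addrA subrr.
Qed.

Hypothesis hid : forall y : H, hidden y -> y = 0.
Hypothesis tr : trivial_overlapping (bdry_set Om)
  (bdry_family (fun k => factor_kernel (@Gamma _ _ _ _ U k))).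

(** The values of the trajectory on the hyperplane form an element of the
    overlapping space of the boundary family. *)
Lemma trajectory_trivial : x = fun=> 0.
Proof.
apply: trajectory_eq0.
pose L k n m (y : H) := Gamma k (m - n) y.
have La k n m : adjoint (L k n m) (GammaA U k (m - n)) := Gamma_adjoint grU k (m - n).
pose HH (j : bdry_index d) : hilbertType R :=
  match j with inl (k, n) => orthsub (joint_ker (L k n)) | _ => H end.
pose coef j : HH j -> fseries d (hsum Es E) :=
  match j with inl (k, n) => fun f m => L k n m (val f) | _ => fun _ _ => 0 end.
have Lperp k n : perp (joint_ker (L k n)) (P k (x n)).
  move=> w hw; rewrite (cproj_adjoint grU) (_ : P k w = 0) ?inner0r //.
  apply/hid/hidden_proj => // m; by have := hw (m + n); rewrite /L addrK.
pose f j : HH j :=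
  match j with
  | inl (k, n) => if degree n == 0 then Orthsub (Lperp k n) else 0
  | _ => 0
  end.
have fE k n : val (f (inl (k, n))) = P k (x n) *+ (degree n == 0).
  by rewrite /f; case: eqP.
suff f0 : forall j, f j = 0.
  move=> n n0; rewrite -[LHS](cproj_sum grU) big1 // => k _.
  by have := congr1 val (f0 (inl (k, n))); rewrite fE n0 eqxx.
have fD j : ~ bdry_set Om j -> f j = 0.
  case: j => [[k n]|[]] // nD; rewrite /f; case: eqP => // n0; case: nD.
  by apply/Om_bdry; exists k, n.
have coefE k n m : coef (inl (k, n)) (f (inl (k, n))) m =
    Gamma k (m - n) (P k (x n)) *+ (degree n == 0).
  rewrite /coef fE /L; case: eqP => //.
  by rewrite (lin0 (Gamma_linear grU _ _)).
apply: (tr (coef := coef)) => // [j /Om_bdry[k [n [-> _]]]||m].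
- exact: (factor_rkhs (La k n)).
- set e := fun p : 'rV[int]_d * 'I_d => inl (p.2, p.1) : bdry_index d.
  have -> : bdry_set Om = e @` ([set n | degree n = 0] `*`` (fun=> setT)).
    apply/seteqP; split=> [j /Om_bdry[k [n [-> n0]]]|_ [[n k] [/= n0 _] <-]].
      by exists (n, k).
    by apply/Om_bdry; exists k, n.
  rewrite esum_image; last by move=> [n k] [n' k'] _ _ [-> ->].
  have le p : ((rnorm (f (e p)) ^+ 2)%:E <= (rnorm (x p.1) ^+ 2)%:E)%E.
    rewrite lee_fin -lecR !rnorm_sqE orthsub_innerE fE.
    case: eqP => _; last by rewrite inner0l inner_ge0.
    exact: proj_norm.
  apply: le_lt_trans (le_esum (fun p _ => le p)) _.
  rewrite -(esum_esum (a := fun n (_ : 'I_d) => (rnorm (x n) ^+ 2)%:E)); last first.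
    by move=> n k _ _; rewrite lee_fin exprn_ge0 // rnorm_ge0.
  under eq_esum => n _.
    rewrite esum_fset; [|exact: finite_finset|]; last first.
      by move=> k _; rewrite lee_fin exprn_ge0 // rnorm_ge0.
    rewrite fsbig_finite; last exact: finite_finset.
    over.
  rewrite /= esum_sum; last by move=> n k _ _; rewrite lee_fin exprn_ge0 // rnorm_ge0.
  by apply: lte_sum_pinfty => k _; exact: sum_x.
pose g k (j : bdry_index d) : hsum Es E :=
  if j is inl (k', n) then
    if k' == k then Gamma k (m - n) (P k (x n)) *+ (degree n == 0) else 0
  else 0.
have gs k : finsum (g k) (v k m).
  apply: (finsum_inj (e := fun n => inl (k, n) : bdry_index d)) (Gamma_finsum k m).
  - by move=> n n' [].
  - by move=> n; rewrite /g eqxx.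
  - move=> [[k' n]|//] nk /=; case: eqP => // kk.
    by have := nk n; rewrite kk eqxx.
have fs : finsum (fun j => coef j (f j) m) (0 : hsum Es E).
  rewrite -(v_sum m); apply: finsum_ext (finsum_sum (index_enum 'I_d) gs) => j.
  case: j => [[k n]|j]; last by rewrite /= big1 //; case: j.
  rewrite coefE (bigD1 k) //= eqxx big1 ?addr0 // => k' k'k.
  by rewrite eq_sym (negPf k'k).
have cD j : ~ bdry_set Om j -> coef j (f j) m = 0.
  move=> /fD ->; case: j => [[k n]|[]] //=.
  exact: (lin0 (Gamma_linear grU _ _)).
exact: (finsum_has_sum (finsum_restrict cD fs)).
Qed.

End minimality.

(** * The colligation of a decomposition *)
Section decompositions.
Variables (R : realType) (d : nat) (E Es : hilbertType R).
Variables (S : 'rV[int]_d -> E -> Es) (K : 'I_d -> fkernel d (hsum Es E)).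
Hypothesis bS : forall n, bounded_op (S n).
Hypothesis agl_dec : aug_agler_decomposition S K.
Hypothesis scc : scc_decomposition K.

(** The state space is the direct sum of the reproducing kernel spaces of the
    kernels [K k]. *)
Lemma exists_good : exists U : colligation d E Es,
  [/\ GR_unitary U, closely_connected U, realizes U S & compatible U K].
Proof.
have [_ KX agl] := agl_dec; have [tr0 tr1] := scc.
pose X k := projT1 (cid (KX k)).
have /(_ _)/cid-/all_tag[L LP] : forall k, exists L : 'rV[int]_d -> X k -> hsum Es E,
    [/\ forall n, bounded_op (L n), K k = factor_kernel L,
        forall n, ~~ nonneg n -> forall x, (L n x).1 = 0
      & forall n, ~~ nonneg (- n - 'e_k) -> forall x, (L n x).2 = 0].
  by move=> k; rewrite /X; case: cid.
have LLa k n : adjoint (L k n) (adj (L k n)) by have [h _ _ _] := LP k; exact: adjP.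
have KE : K = fun k => factor_kernel (L k) by apply/funext => k; have [_ -> _ _] := LP k.
pose Y k : hilbertType R := orthsub (joint_ker (L k)).
pose F k n (y : Y k) := L k n (val y).
pose Fa k n (g : hsum Es E) : Y k := Orthsub (joint_ker_perp (LLa k) n g).
have FFa k n : adjoint (F k n) (Fa k n).
  by move=> y g; rewrite LLa.
have Kfun : (fun k n m v => F k n (Fa k m v)) = K by rewrite KE.
have := exists_colligation bS FFa.
rewrite Kfun; apply.
- by move=> k n y nn; have [_ _ h _] := LP k; exact: h.
- by move=> k n y nn; have [_ _ _ h] := LP k; exact: h.
- move=> y y0; apply/functional_extensionality_dep => k; apply: val_inj.
  rewrite KE in tr0.
  by apply: (overlap_free LLa tr0 (f := fun k => val (y k))) => // j; exact: orthsubP.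
- move=> y y0; apply/functional_extensionality_dep => k; apply: val_inj.
  rewrite KE in tr1.
  apply: (overlap_free (L := fun k n => L k (n - 'e_k)) (fun k n => LLa k (n - 'e_k)) tr1
    (f := fun k => val (y k))) => // j w hw.
  by apply: (orthsubP (y j)) => n; have := hw (n + 'e_j); rewrite addrK.
- by move=> n m v; rewrite agl; apply: eq_bigr => k _; rewrite -Kfun.
Qed.

Section one_good.
Variable U : colligation d E Es.
Hypotheses (grU : GR_unitary U) (ccU : closely_connected U).
Hypotheses (rU : realizes U S) (cU : compatible U K).

Let KE : K = fun k => factor_kernel (@Gamma _ _ _ _ U k).
Proof. by apply/funext. Qed.

Let tr0 : trivial_overlapping setT (fun k => factor_kernel (@Gamma _ _ _ _ U k)).
Proof. by rewrite -KE; have [] := scc. Qed.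

Let tr1 : trivial_overlapping setT
  (fun k => shift_kernel 'e_k (factor_kernel (@Gamma _ _ _ _ U k))).
Proof. by have [_] := scc; rewrite KE. Qed.

Lemma good_hidden x : hidden (U := U) x -> x = 0.
Proof. exact: (hidden_trivial grU bS rU tr0 tr1 ccU). Qed.

Lemma good_strictly_closely_connected : strictly_closely_connected U.
Proof. exact: (good_scc grU bS rU tr0 tr1 ccU). Qed.

Lemma good_shift_alpha_inj (y : state U) (q : Es) (y' : state U) q' :
  (forall n, Gamma_shift n y + alpha S n q = Gamma_shift n y' + alpha S n q') ->
  y = y' /\ q = q'.
Proof. exact: (Gamma_shift_alpha_inj grU bS rU tr0 tr1 ccU). Qed.

Lemma good_scattering_minimal : minimal_decomposition K -> scattering_minimal U.
Proof.
move=> [_ mK] x tx ax; apply: (trajectory_trivial grU tx ax good_hidden).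
rewrite -KE; apply: mK => k n /= nn.
by rewrite degreeDe addr_ge0.
Qed.

End one_good.
End decompositions.

Theorem corollary7p3 (R : realType) (d : nat) (_ : (0 < d)%N)
    (E Es : hilbertType R) (S : 'rV[int]_d -> E -> Es)
    (K : 'I_d -> fkernel d (hsum Es E)) :
  schur_agler S ->
  aug_agler_decomposition S K ->
  scc_decomposition K ->
  let good (U : colligation d E Es) :=
    [/\ GR_unitary U, closely_connected U, realizes U S & compatible U K] in
  (exists2 U, good U & forall U', good U' -> unitarily_equivalent U U') /\
  (forall U, good U ->
     strictly_closely_connected U /\
     (minimal_decomposition K -> scattering_minimal U)).
Proof.
move=> [bS _ _ _] agl_dec scc good; split; last first.
  move=> U [grU ccU rU cU]; split.
    exact: (good_strictly_closely_connected bS scc grU ccU rU cU).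
  exact: (good_scattering_minimal bS scc grU ccU rU cU).
have [U gU] := exists_good bS agl_dec scc.
exists U => // U' [grU' ccU' rU' cU']; have [grU ccU rU cU] := gU.
apply: (compatible_unitarily_equivalent grU grU' rU rU').
- by move=> k; rewrite -cU -cU'.
- exact: (good_hidden bS scc grU ccU rU cU).
- exact: (good_hidden bS scc grU' ccU' rU' cU').
- exact: (good_shift_alpha_inj bS scc grU' ccU' rU' cU').
Qed.
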